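(* Let $\mathscr{K}^{\bullet}$ be a complex of fine sheaves on a paracompact space $X$ and let $\mathscr{S}$ be the kernel of $d_{\mathscr{K}}:\mathscr{K}^{0}\to\mathscr{K}^{1}$. Let $\mathcal{W}=\{W_\alpha\}_{\alpha\in I}$ denote a locally finite open covering of $X$, $X'\subset X$ an open set, and $\mathcal{W}'=\{W_\alpha\}_{\alpha\in I'}$, $I'\subset I$, a subfamily covering $X'$. 1. For any covering $\mathcal{W}$ of $X$, there is a canonical isomorphism $H^{q}_{d_{\mathscr{K}}}(X)\overset{\sim}{\longrightarrow}H^{q}(\mathcal{W};\mathscr{K}^{\bullet})$. 2. If $\mathcal{W}$ is good for $\mathscr{K}^{\bullet}$, there is a canonical isomorphism $H^{q}(\mathcal{W},\mathcal{W}';\mathscr{S})\overset{\sim}{\longrightarrow}H^{q}(\mathcal{W},\mathcal{W}';\mathscr{K}^{\bullet})$. 3. Suppose every open set in $X$ is paracompact. If $\mathcal{W}$ is good for $\mathscr{K}^{\bullet}$ and if $0\to\mathscr{S}\to\mathscr{K}^{\bullet}$ is a resolution, then $H^{q}(\mathcal{W},\mathcal{W}';\mathscr{S})\simeq H^{q}(X,X';\mathscr{S})$.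
   Context: Sheaves are sheaves of abelian groups; complexes of sheaves vanish in negative degrees. Paracompact means Hausdorff and every open covering admits a locally finite refinement. A sheaf $\mathscr{G}$ on a paracompact space is soft if its global sections restrict surjectively onto sections over every closed subset; it is fine if $\mathscr{H}om(\mathscr{G},\mathscr{G})$ is soft. $H^q_{d_{\mathscr{K}}}(X)$ is the cohomology of $(\mathscr{K}^\bullet(X),d)$. $H^q(X,X';\mathscr{S})$ is the cohomology of the complex of sections over $X$ vanishing on $X'$ of a flabby (e.g. Godement) resolution of $\mathscr{S}$. Čech cochains: write $W_{\alpha_0\dots\alpha_q}=W_{\alpha_0}\cap\dots\cap W_{\alpha_q}$. For a sheaf $\mathscr{A}$, $C^q(\mathcal{W};\mathscr{A})=\prod_{(\alpha_0,\dots,\alpha_q)\in I^{q+1}}\mathscr{A}(W_{\alpha_0\dots\alpha_q})$, with $(\check\delta\sigma)_{\alpha_0\dots\alpha_{q+1}}=\sum_{\nu=0}^{q+1}(-1)^\nu\sigma_{\alpha_0\dots\widehat{\alpha_\nu}\dots\alpha_{q+1}}$, and $C^q(\mathcal{W},\mathcal{W}';\mathscr{A})$ is the subgroup of $\sigma$ with $\sigma_{\alpha_0\dots\alpha_q}=0$ whenever all $\alpha_j\in I'$. $H^q(\mathcal{W},\mathcal{W}';\mathscr{A})$ is the cohomology of $(C^\bullet(\mathcal{W},\mathcal{W}';\mathscr{A}),\check\delta)$. Čech cohomology of the complex: $\mathscr{K}^q(\mathcal{W},\mathcal{W}')=\bigoplus_{q_1+q_2=q}C^{q_1}(\mathcal{W},\mathcal{W}';\mathscr{K}^{q_2})$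 with differential $D=\check\delta+(-1)^{q_1}d$ on $C^{q_1}(\mathcal{W},\mathcal{W}';\mathscr{K}^{q_2})$; $H^q(\mathcal{W},\mathcal{W}';\mathscr{K}^\bullet)$ is its cohomology, and $H^q(\mathcal{W};\mathscr{K}^\bullet)$ is the case $X'=\emptyset$, $I'=\emptyset$. The canonical map in 1 is induced by the inclusion $\mathscr{K}^q(X)\hookrightarrow C^0(\mathcal{W};\mathscr{K}^q)\subset\mathscr{K}^q(\mathcal{W})$, and the canonical map in 2 by the inclusion $C^q(\mathcal{W},\mathcal{W}';\mathscr{S})\hookrightarrow C^q(\mathcal{W},\mathcal{W}';\mathscr{K}^0)\subset\mathscr{K}^q(\mathcal{W},\mathcal{W}')$. $\mathcal{W}$ is good for $\mathscr{K}^\bullet$ if $H^{q_2}(\mathscr{K}^\bullet(W_{\alpha_0\dots\alpha_{q_1}}))=0$ for all $q_1\ge0$, $q_2\ge1$ and all indices.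
   Formalization: The subfamily W' is taken to cover X' exactly, i.e. X' is the union of the W_α with α in I'; with mere containment of X' in that union part 3 fails (X a point, I' = I, X' empty, S = Z: the left side is 0, the right side is Z for q = 0). *)

(* Defs.v *)
From HB Require Import structures.
From mathcomp Require Import all_boot all_algebra.
From mathcomp Require Import boolp classical_sets functions cardinality.
From mathcomp Require Import topology zify.

Set Implicit Arguments.
Unset Strict Implicit.
Unset Printing Implicit Defensive.

Import GRing.Theory Quotient.

Local Open Scope classical_set_scope.
Local Open Scope ring_scope.
Local Open Scope quotient_scope.

Section Coverings.
Context {T : topologicalType} {I : Type}.
Implicit Type F : I -> set T.

Definition locally_finite F := forall x : T,
  exists2 N : set T, nbhs x N & finite_set [set i | F i `&` N !=set0].

Definition open_covering F :=
  (forall i, open (F i)) /\ cover [set: I] F = [set: T].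

End Coverings.

Definition paracompact (T : topologicalType) : Prop :=
  hausdorff_space T /\
  forall (I : Type) (F : I -> set T), open_covering F ->
    exists (J : Type) (G : J -> set T),
      [/\ open_covering G, locally_finite G
        & forall j, exists i, G j `<=` F i].

Record opens (X : topologicalType) := Opens {
  oset :> set X;
  open_oset : open oset
}.

Identity Coercion pred_of_set : set >-> Funclass.

Section Opens.
Context {X : topologicalType}.
Implicit Types U V : opens X.

Definition oT : opens X := Opens openT.

Definition oI U V : opens X := Opens (openI (open_oset U) (open_oset V)).

Lemma oIl U V : oI U V `<=` U. Proof. exact: subIsetl. Qed.

Lemma oIr U V : oI U V `<=` V. Proof. exact: subIsetr. Qed.

Lemma sub_oT U : U `<=` oT. Proof. by []. Qed.

End Opens.

Section DependentProduct.
Context {J : Type} (T : J -> zmodType).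

Definition dprod : Type := forall j, T j.

HB.instance Definition _ := gen_eqMixin dprod.
HB.instance Definition _ := gen_choiceMixin dprod.

Let zero : dprod := fun=> 0.
Let opp (x : dprod) : dprod := fun j => - x j.
Let add (x y : dprod) : dprod := fun j => x j + y j.

Fact dprod_addA : associative add.
Proof. by move=> x y z; apply: functional_extensionality_dep => j; exact: addrA. Qed.
Fact dprod_addC : commutative add.
Proof. by move=> x y; apply: functional_extensionality_dep => j; exact: addrC. Qed.
Fact dprod_add0 : left_id zero add.
Proof. by move=> x; apply: functional_extensionality_dep => j; exact: add0r. Qed.
Fact dprod_addN : left_inverse zero opp add.
Proof. by move=> x; apply: functional_extensionality_dep => j; exact: addNr. Qed.

HB.instance Definition _ :=
  GRing.isZmodule.Build dprod dprod_addA dprod_addC dprod_add0 dprod_addN.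

Lemma dprod0E j : (0 : dprod) j = 0. Proof. by []. Qed.
Lemma dprodDE (x y : dprod) j : (x + y) j = x j + y j. Proof. by []. Qed.
Lemma dprodNE (x : dprod) j : (- x) j = - x j. Proof. by []. Qed.
Lemma dprodBE (x y : dprod) j : (x - y) j = x j - y j. Proof. by []. Qed.

Lemma dprodP (x y : dprod) : (forall j, x j = y j) -> x = y.
Proof. exact: functional_extensionality_dep. Qed.

End DependentProduct.

Section Subgroup.
Context {A : zmodType} (S : zmodClosed A).

Definition subgrp : Type := {x : A | x \in S}.

HB.instance Definition _ := SubChoice.on subgrp.
HB.instance Definition _ := [SubChoice_isSubZmodule of subgrp by <:].

End Subgroup.

Section Kernel.
Context {A B : zmodType} (f : {additive A -> B}).

Definition ker_pred : A -> bool := fun x => f x == 0.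

Fact ker_closed : zmod_closed ker_pred.
Proof.
by split=> [|x y /eqP fx /eqP fy]; rewrite unfold_in /= ?raddf0 // raddfB fx fy subrr.
Qed.

HB.instance Definition _ := GRing.isZmodClosed.Build A ker_pred ker_closed.

Definition ker : zmodClosed A := GRing.ZmodClosed.clone A ker_pred _.

Lemma kerE x : (x \in ker) = (f x == 0). Proof. by []. Qed.

End Kernel.

Section SubgroupMap.
Context {A B : zmodType} (f : {additive A -> B}).
Context (S : zmodClosed A) (T : zmodClosed B).
Hypothesis fST : forall x, x \in S -> f x \in T.

Definition subgrp_map (x : subgrp S) : subgrp T := 
  exist (fun y => y \in T) (f (val x)) (fST (valP x)).

Fact subgrp_map_additive : zmod_morphism subgrp_map.
Proof. by move=> x y; apply: val_inj; rewrite /= !raddfB. Qed.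

HB.instance Definition _ :=
  GRing.isZmodMorphism.Build (subgrp S) (subgrp T) subgrp_map
    subgrp_map_additive.

Definition quot_map of (forall x, x \in S -> f x \in T) :=
  fun x : {quot S} => \pi_{quot T} (f (repr x)) : {quot T}.

Lemma quot_mapE x : quot_map fST (\pi x) = \pi_{quot T} (f x).
Proof.
apply/eqP; rewrite /quot_map -idealrBE -raddfB; apply: fST.
by rewrite idealrBE reprK.
Qed.

Fact quot_map_additive : zmod_morphism (quot_map fST).
Proof.
move=> x y; rewrite -[x]reprK -[y]reprK -raddfB !quot_mapE.
by rewrite !raddfB.
Qed.

HB.instance Definition _ :=
  GRing.isZmodMorphism.Build {quot S} {quot T} (quot_map fST)
    quot_map_additive.

End SubgroupMap.

Record complex := Complex {
  cobj :> nat -> zmodType;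
  diff : forall q, {additive cobj q -> cobj q.+1};
  diffK : forall q (x : cobj q), diff q.+1 (diff q x) = 0
}.

Record cmap (C D : complex) := CMap {
  cmor :> forall q, {additive C q -> D q};
  cmor_diff : forall q (x : C q), cmor q.+1 (diff C q x) = diff D q (cmor q x)
}.

Section Cohomology.
Implicit Types (C D : complex).

Definition cocycle C q : zmodType := subgrp (ker (diff C q)).

Definition coboundary C q : set (C q) :=
  match q with
  | 0 => [set 0]
  | p.+1 => range (diff C p)
  end.

Definition exact_pred C q : cocycle C q -> bool :=
  fun z => `[< @coboundary C q (val z) >].

Fact exact_closed C q : zmod_closed (@exact_pred C q).
Proof.
split=> [|x y]; rewrite !unfold_in /=.
  by apply/asboolP; case: q => [//|q]; exists 0 => //; rewrite raddf0.
move=> /asboolP xB /asboolP yB; apply/asboolP.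
case: q x y xB yB => [|q] x y /=; first by move=> -> ->; rewrite subrr.
by move=> [u _ <-] [v _ <-]; exists (u - v) => //; rewrite raddfB.
Qed.

HB.instance Definition _ C q :=
  GRing.isZmodClosed.Build (cocycle C q) (@exact_pred C q) (exact_closed C q).

Definition exact_cocycle C q : zmodClosed (cocycle C q) :=
  GRing.ZmodClosed.clone (cocycle C q) (@exact_pred C q) _.

Definition cohomology C q : zmodType := {quot (exact_cocycle C q)}.

Context {C D : complex} (f : cmap C D).

Fact cmap_cocycle q x : x \in ker (diff C q) -> f q x \in ker (diff D q).
Proof. by rewrite !kerE -cmor_diff => /eqP->; rewrite raddf0. Qed.

Fact cmap_exact q (z : cocycle C q) : z \in exact_cocycle C q ->
  subgrp_map (@cmap_cocycle q) z \in exact_cocycle D q.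
Proof.
rewrite !unfold_in => /asboolP h; apply/asboolP; move: h.
case: q z => [|q] z /=; first by move=> ->; rewrite raddf0.
by move=> [u _ <-]; exists (f q u) => //; rewrite cmor_diff.
Qed.

Definition coh_map q : {additive cohomology C q -> cohomology D q} :=
  quot_map (@cmap_exact q).

End Cohomology.

Section Subcomplex.
Context (C : complex) (S : forall q, zmodClosed (C q)).
Hypothesis dS : forall q x, x \in S q -> diff C q x \in S q.+1.

Fact subcomplex_diffK q (x : subgrp (S q)) :
  subgrp_map (@dS q.+1) (subgrp_map (@dS q) x) = 0.
Proof. by apply: val_inj; rewrite /= diffK. Qed.

Definition subcomplex : complex := Complex subcomplex_diffK.

End Subcomplex.

Record bicomplex := Bicomplex {
  bobj :> nat -> nat -> zmodType;
  bdel : forall p r, {additive bobj p r -> bobj p.+1 r};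
  bdif : forall p r, {additive bobj p r -> bobj p r.+1};
  bdelK : forall p r (x : bobj p r), bdel p.+1 r (bdel p r x) = 0;
  bdifK : forall p r (x : bobj p r), bdif p r.+1 (bdif p r x) = 0;
  bdelC : forall p r (x : bobj p r),
    bdel p r.+1 (bdif p r x) = bdif p.+1 r (bdel p r x)
}.

Section Total.
Context (B : bicomplex).

Definition bidegree (q : nat) := {pr : nat * nat | (pr.1 + pr.2)%N = q}.

Definition bideg q p r (h : (p + r)%N = q) : bidegree q :=
  exist (fun pr : nat * nat => (pr.1 + pr.2)%N = q) (p, r) h.

(* The sum over the finitely many (p, r) with p + r = q; quantifying over the
   proof of p + r = q avoids the transports that an indexing by p alone would
   require. *)
Definition tot (q : nat) : zmodType :=
  dprod (fun i : bidegree q => B (sval i).1 (sval i).2).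

Definition tot_del q (x : tot q) (p r : nat) : (p + r)%N = q.+1 -> B p r :=
  match p return (p + r)%N = q.+1 -> B p r with
  | 0 => fun=> 0
  | p'.+1 => fun h => bdel B p' r (x (bideg (succn_inj h)))
  end.

Definition tot_dif q (x : tot q) (p r : nat) : (p + r)%N = q.+1 -> B p r :=
  match r return (p + r)%N = q.+1 -> B p r with
  | 0 => fun=> 0
  | r'.+1 => fun h =>
      bdif B p r' (x (bideg (succn_inj (etrans (esym (addnS p r')) h))))
        *~ (-1) ^+ p
  end.

Definition tot_diff q (x : tot q) : tot q.+1 :=
  fun i => tot_del x (proj2_sig i) + tot_dif x (proj2_sig i).

Fact tot_del_additive q (x y : tot q) p r (h : (p + r)%N = q.+1) :
  tot_del (x - y) h = tot_del x h - tot_del y h.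
Proof.
case: p h => [|p] h /=; first by rewrite subr0.
by rewrite dprodBE raddfB.
Qed.

Fact tot_dif_additive q (x y : tot q) p r (h : (p + r)%N = q.+1) :
  tot_dif (x - y) h = tot_dif x h - tot_dif y h.
Proof.
case: r h => [|r] h /=; first by rewrite subr0.
by rewrite dprodBE raddfB mulrzBl.
Qed.

Fact tot_diff_additive q : zmod_morphism (@tot_diff q).
Proof.
move=> x y; apply: dprodP => i; rewrite dprodBE /tot_diff.
by rewrite tot_del_additive tot_dif_additive opprD addrACA.
Qed.

HB.instance Definition _ q :=
  GRing.isZmodMorphism.Build (tot q) (tot q.+1) (@tot_diff q)
    (@tot_diff_additive q).

Lemma tot_delE q (x : tot q) p r (h : (p.+1 + r)%N = q.+1) (h' : (p + r)%N = q) :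
  tot_del x h = bdel B p r (x (bideg h')).
Proof. by rewrite /=; congr (bdel _ _ _ (x (bideg _))); exact: Prop_irrelevance. Qed.

Lemma tot_difE q (x : tot q) p r (h : (p + r.+1)%N = q.+1) (h' : (p + r)%N = q) :
  tot_dif x h = bdif B p r (x (bideg h')) *~ (-1) ^+ p.
Proof. by rewrite /=; congr (bdif _ _ _ (x (bideg _)) *~ _); exact: Prop_irrelevance. Qed.

Lemma tot_diffE q (x : tot q) p r (h : (p + r)%N = q.+1) :
  tot_diff x (bideg h) = tot_del x h + tot_dif x h.
Proof. by []. Qed.

Fact tot_diffK q (x : tot q) : tot_diff (tot_diff x) = 0.
Proof.
apply: dprodP => -[[p r] h]; rewrite dprod0E [LHS]tot_diffE /=.
have -> : tot_del (tot_diff x) h =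
  match p return (p + r)%N = q.+2 -> B p r with
  | 0 => fun=> 0
  | p'.+1 => fun h => bdel B p' r (tot_dif x (succn_inj h))
  end h.
  case: p h => [//|p] h /=; rewrite tot_diffE raddfD /=.
  case: p h => [|p] h /=; first by rewrite raddf0 add0r.
  by rewrite bdelK add0r.
have -> : tot_dif (tot_diff x) h =
  match r return (p + r)%N = q.+2 -> B p r with
  | 0 => fun=> 0
  | r'.+1 => fun h => bdif B p r' (tot_del x
       (succn_inj (etrans (esym (addnS p r')) h))) *~ (-1) ^+ p
  end h.
  case: r h => [//|r] h /=; set h1 := succn_inj _; rewrite (tot_diffE x h1) raddfD /=.
  case: r h @h1 => [|r] h h1; first by rewrite /= raddf0 addr0.
  by rewrite /= raddfMz /= bdifK mul0rz addr0.
case: p r h => [|p] [|r] h; first by rewrite addr0.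
- by rewrite /= raddf0 mul0rz addr0.
- by rewrite /= raddf0 addr0.
have h' : (p + r)%N = q by move: h; rewrite addSn addnS => -[].
rewrite (tot_difE _ _ h') (tot_delE _ _ h').
by rewrite raddfMz /= bdelC exprS mulN1r mulrNz addrN.
Qed.

Definition total : complex := Complex tot_diffK.

End Total.

Section EdgeMaps.
Context (A : complex) (B : bicomplex).

Section EdgeP0.
Context (f : forall q, {additive A q -> B 0%N q}).
Hypothesis f_del : forall q (x : A q), bdel B 0%N q (f q x) = 0.
Hypothesis f_dif : forall q (x : A q), bdif B 0%N q (f q x) = f q.+1 (diff A q x).

Definition edge_p0 q (x : A q) p r : (p + r)%N = q -> B p r :=
  match p return (p + r)%N = q -> B p r with
  | 0 => fun h : (0 + r)%N = q => f r (ecast i (A i) (esym h) x)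
  | _.+1 => fun=> 0
  end.

Definition edge_p0_tot q (x : A q) : tot B q := fun i => edge_p0 x (proj2_sig i).

Fact edge_p0_additive q : zmod_morphism (@edge_p0_tot q).
Proof.
move=> x y; apply: dprodP => -[[[|p] r] h]; rewrite dprodBE /edge_p0_tot /=.
  by move: (h : r = q) x y => /= {}h; subst r => x y; rewrite !eq_axiomK /= raddfB.
by rewrite subrr.
Qed.

HB.instance Definition _ q :=
  GRing.isZmodMorphism.Build (A q) (tot B q) (@edge_p0_tot q)
    (@edge_p0_additive q).

Fact edge_p0_diff q (x : A q) :
  edge_p0_tot (diff A q x) = tot_diff (edge_p0_tot x).
Proof.
apply: dprodP => -[[p r] h]; rewrite -[exist _ _ _]/(bideg h) tot_diffE.
rewrite /edge_p0_tot [LHS]/=; case: p h => [|p] h.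
  rewrite add0r; move: (h : r = q.+1) => /= {}h; subst r.
  rewrite eq_axiomK /= /edge_p0_tot /=; set e := succn_inj _.
  by rewrite (eq_axiomK e) /= expr0 mulr1z f_dif.
case: p h => [|p] h.
  have h' : (0 + r)%N = q by move: h => /= /succn_inj.
  rewrite (tot_delE _ _ h') [RHS]/=.
  case: r h h' => [|r] h h' /=.
    by rewrite addr0 /edge_p0_tot /= f_del.
  by rewrite /edge_p0_tot /= f_del raddf0 mul0rz addr0.
case: r h => [|r] h /=.
  by rewrite /edge_p0_tot /= raddf0 addr0.
by rewrite /edge_p0_tot /= !raddf0 mul0rz addr0.
Qed.

Definition edge_p0_cmap : cmap A (total B) :=
  @CMap A (total B) (fun q => @edge_p0_tot q) edge_p0_diff.

End EdgeP0.

Section EdgeR0.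
Context (f : forall q, {additive A q -> B q 0%N}).
Hypothesis f_dif : forall q (x : A q), bdif B q 0 (f q x) = 0.
Hypothesis f_del : forall q (x : A q), bdel B q 0 (f q x) = f q.+1 (diff A q x).

Definition edge_r0 q (x : A q) p r : (p + r)%N = q -> B p r :=
  match r return (p + r)%N = q -> B p r with
  | 0 => fun h : (p + 0)%N = q =>
      f p (ecast i (A i) (etrans (esym h) (addn0 p)) x)
  | _.+1 => fun=> 0
  end.

Definition edge_r0_tot q (x : A q) : tot B q := fun i => edge_r0 x (proj2_sig i).

Fact edge_r0_additive q : zmod_morphism (@edge_r0_tot q).
Proof.
move=> x y; apply: dprodP => -[[p [|r]] h]; rewrite dprodBE /edge_r0_tot /=.
  set e := etrans _ _; clearbody e; move: e x y => /= {}h.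
  by subst p => x y /=; rewrite raddfB.
by rewrite subrr.
Qed.

HB.instance Definition _ q :=
  GRing.isZmodMorphism.Build (A q) (tot B q) (@edge_r0_tot q)
    (@edge_r0_additive q).

Fact edge_r0_diff q (x : A q) :
  edge_r0_tot (diff A q x) = tot_diff (edge_r0_tot x).
Proof.
apply: dprodP => -[[p r] h]; rewrite -[exist _ _ _]/(bideg h) tot_diffE.
rewrite /edge_r0_tot [LHS]/=; case: r h => [|r] h.
  rewrite addr0; case: p h => [//|p] h /=.
  rewrite /edge_r0_tot /=; set e := etrans _ _; set e' := etrans _ _.
  clearbody e e'; move: (e') => /= {}h; subst p.
  by rewrite !eq_axiomK /= f_del.
have h' : (p + r)%N = q by move: h; rewrite addnS => -[].
rewrite (tot_difE _ _ h'); case: p h h' => [|p] h h' /=.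
  rewrite add0r /edge_r0_tot /=.
  by case: r h h' => [|r] h h' /=; rewrite ?f_dif ?raddf0 mul0rz.
rewrite /edge_r0_tot /= raddf0 add0r.
by case: r h h' => [|r] h h' /=; rewrite ?f_dif ?raddf0 mul0rz.
Qed.

Definition edge_r0_cmap : cmap A (total B) :=
  @CMap A (total B) (fun q => @edge_r0_tot q) edge_r0_diff.

End EdgeR0.

End EdgeMaps.

Record presheaf (X : topologicalType) := Presheaf {
  sections :> opens X -> zmodType;
  res : forall U V : opens X, V `<=` U -> {additive sections U -> sections V};
  res_id : forall (U : opens X) (h : U `<=` U) s, res h s = s;
  res_comp : forall (U V W : opens X)
    (hVU : V `<=` U) (hWV : W `<=` V) (hWU : W `<=` U) s,
    res hWV (res hVU s) = res hWU s
}.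
Arguments res {X} p {U V}.

Definition is_sheaf (X : topologicalType) (F : presheaf X) : Prop :=
  forall (U : opens X) (I : Type) (V : I -> opens X)
    (hV : forall i, V i `<=` U), U `<=` \bigcup_i V i ->
  forall s : (forall i, F (V i)),
    (forall i j, res F (@oIl _ (V i) (V j)) (s i)
               = res F (@oIr _ (V i) (V j)) (s j)) ->
  exists! t : F U, forall i, res F (hV i) t = s i.

Record sheaf (X : topologicalType) := Sheaf {
  sheaf_pre :> presheaf X;
  sheafP : is_sheaf sheaf_pre
}.

Record sheaf_hom (X : topologicalType) (F G : presheaf X) := Hom {
  hom_app :> forall U : opens X, {additive F U -> G U};
  hom_nat : forall (U V : opens X) (h : V `<=` U) (s : F U),
    hom_app V (res F h s) = res G h (hom_app U s)
}.

Section SheafLemmas.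
Context {X : topologicalType}.
Implicit Types U V : opens X.

Lemma res_irr (F : presheaf X) U V (h h' : V `<=` U) s :
  res F h s = res F h' s.
Proof. by congr (res F _ s); exact: Prop_irrelevance. Qed.

Lemma sheaf_sep (F : sheaf X) U (I : Type) (V : I -> opens X)
    (hV : forall i, V i `<=` U) (s t : F U) : U `<=` \bigcup_i V i ->
  (forall i, res F (hV i) s = res F (hV i) t) -> s = t.
Proof.
move=> cU st.
have [|u [_ uu]] := @sheafP X F U I V hV cU (fun i => res F (hV i) t).
  by move=> i j; rewrite !(res_comp _ _ (subset_trans (@oIl _ _ _) (hV i))).
by rewrite -(uu t) // (uu s).
Qed.

End SheafLemmas.

Section KernelSheaf.
Context {X : topologicalType} {F G : sheaf X} (f : sheaf_hom F G).
Implicit Types U V W : opens X.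

Definition ker_sections U : zmodType := subgrp (ker (f U)).

Fact ker_res_subproof U V (h : V `<=` U) s :
  s \in ker (f U) -> res F h s \in ker (f V).
Proof. by rewrite !kerE hom_nat => /eqP->; rewrite raddf0. Qed.

Definition ker_res U V (h : V `<=` U) :
    {additive ker_sections U -> ker_sections V} :=
  subgrp_map (@ker_res_subproof U V h).

Fact ker_res_id U (h : U `<=` U) s : ker_res h s = s.
Proof. by apply: val_inj; exact: res_id. Qed.

Fact ker_res_comp U V W (hVU : V `<=` U) (hWV : W `<=` V) (hWU : W `<=` U) s :
  ker_res hWV (ker_res hVU s) = ker_res hWU s.
Proof. by apply: val_inj; exact: res_comp. Qed.

Definition ker_presheaf : presheaf X := Presheaf ker_res_id ker_res_comp.

Fact ker_is_sheaf : is_sheaf ker_presheaf.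
Proof.
move=> U I V hV cU s sc.
have [|t [tE tu]] := @sheafP X F U I V hV cU (fun i => val (s i)).
  by move=> i j; have /(congr1 val) := sc i j.
have kt : t \in ker (f U).
  rewrite kerE; apply/eqP/(sheaf_sep (hV := hV)) => // i.
  by rewrite -hom_nat tE raddf0; apply/eqP; exact: valP (s i).
exists (exist (fun y => y \in ker (f U)) t kt); split.
  by move=> i; apply: val_inj; exact: tE.
by move=> u uE; apply: val_inj; apply: tu => i; rewrite -uE.
Qed.

Definition ker_sheaf : sheaf X := Sheaf ker_is_sheaf.

Definition ker_incl_app U : {additive ker_sheaf U -> F U} := \val.

Fact ker_incl_nat U V (h : V `<=` U) (s : ker_sheaf U) :
  ker_incl_app V (res ker_sheaf h s) = res F h (ker_incl_app U s).
Proof. by []. Qed.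

Definition ker_incl : sheaf_hom ker_sheaf F := Hom ker_incl_nat.

End KernelSheaf.

Section HomSheaf.
Context {X : topologicalType} (F G : sheaf X).
Implicit Types U V W : opens X.

Definition opens_in U := {V : opens X | V `<=` U}.

Definition inside U V (h : V `<=` U) : opens_in U :=
  exist (fun W => W `<=` U) V h.

Definition hom_ambient U : zmodType :=
  dprod (fun V : opens_in U => dprod (fun _ : F (sval V) => G (sval V))).

Definition is_hom U (phi : hom_ambient U) : Prop :=
  (forall V : opens_in U, zmod_morphism (phi V : F (sval V) -> G (sval V))) /\
  (forall (D E : opens_in U) (h : sval E `<=` sval D) s,
     phi E (res F h s) = res G h (phi D s)).

Definition hom_pred U : hom_ambient U -> bool := fun phi => `[< is_hom phi >].

Fact hom_closed U : zmod_closed (@hom_pred U).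
Proof.
split=> [|f g]; rewrite !unfold_in.
  apply/asboolP; split=> [V x y|V W h s]; rewrite ?dprod0E ?subrr //.
  by rewrite raddf0.
move=> /asboolP[fa fn] /asboolP[ga gn]; apply/asboolP.
split=> [V x y|V W h s]; rewrite !dprodBE; last by rewrite fn gn raddfB.
by rewrite fa ga !opprD !opprK addrACA.
Qed.

HB.instance Definition _ U :=
  GRing.isZmodClosed.Build (hom_ambient U) (@hom_pred U) (hom_closed U).

Definition hom_group U : zmodClosed (hom_ambient U) :=
  GRing.ZmodClosed.clone (hom_ambient U) (@hom_pred U) _.

Definition hom_sections U : zmodType := subgrp (hom_group U).

Definition opens_in_sub U V (h : V `<=` U) (D : opens_in V) : opens_in U :=
  inside (subset_trans (proj2_sig D) h).

Definition hom_ambient_res U V (h : V `<=` U) (phi : hom_ambient U) :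
  hom_ambient V := fun D => phi (opens_in_sub h D).

Fact hom_ambient_res_additive U V (h : V `<=` U) :
  zmod_morphism (hom_ambient_res h).
Proof. by []. Qed.

HB.instance Definition _ U V (h : V `<=` U) :=
  GRing.isZmodMorphism.Build (hom_ambient U) (hom_ambient V)
    (hom_ambient_res h) (hom_ambient_res_additive h).

Fact hom_res_subproof U V (h : V `<=` U) phi :
  phi \in hom_group U -> hom_ambient_res h phi \in hom_group V.
Proof.
rewrite !unfold_in => /asboolP[pa pn]; apply/asboolP.
split=> [W|W W1 hW s]; first exact: (pa (opens_in_sub h W)).
exact: (pn (opens_in_sub h W) (opens_in_sub h W1)).
Qed.

Definition hom_res U V (h : V `<=` U) :
    {additive hom_sections U -> hom_sections V} :=
  subgrp_map (@hom_res_subproof U V h).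

Fact hom_res_id U (h : U `<=` U) s : hom_res h s = s.
Proof.
apply: val_inj; apply: dprodP => -[V hV] /=; rewrite /hom_ambient_res.
by rewrite /opens_in_sub /= (Prop_irrelevance (subset_trans _ _) hV).
Qed.

Fact hom_res_comp U V W (hVU : V `<=` U) (hWV : W `<=` V) (hWU : W `<=` U) s :
  hom_res hWV (hom_res hVU s) = hom_res hWU s.
Proof.
apply: val_inj; apply: dprodP => -[V' hV'] /=; rewrite /hom_ambient_res.
rewrite /opens_in_sub /=; set a := subset_trans _ _; set b := subset_trans _ _.
by rewrite (Prop_irrelevance a b).
Qed.

Definition hom_presheaf : presheaf X := Presheaf hom_res_id hom_res_comp.

Lemma hom_val_irr U (phi : hom_ambient U) V (h h' : V `<=` U) (s : F V) :
  phi (inside h) s = phi (inside h') s.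
Proof. by rewrite (Prop_irrelevance h h'). Qed.

Lemma hom_valP U (phi : hom_sections U) : is_hom (val phi).
Proof. by apply/asboolP; exact: (valP phi). Qed.

Section Gluing.
Context (U : opens X) (I : Type) (V : I -> opens X).
Hypothesis hV : forall i, V i `<=` U.
Hypothesis cU : U `<=` \bigcup_i V i.
Context (s : forall i, hom_sections (V i)).
Hypothesis sc : forall i j,
  hom_res (@oIl _ (V i) (V j)) (s i) = hom_res (@oIr _ (V i) (V j)) (s j).

Local Notation p i := (val (s i) : hom_ambient (V i)).

Lemma glue_compat i j W (hi : W `<=` V i) (hj : W `<=` V j) (x : F W) :
  p i (inside hi) x = p j (inside hj) x.
Proof.
have hW : W `<=` oI (V i) (V j) by move=> z Wz; split; [exact: hi|exact: hj].
have /(congr1 val)/(congr1 (fun f : hom_ambient _ => f (inside hW))) := sc i j.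
move=> /(congr1 (fun f => f x)); rewrite /= /hom_ambient_res /opens_in_sub /=.
by rewrite (hom_val_irr _ _ hi) (hom_val_irr _ _ hj).
Qed.

Lemma glue_nat i W W1 (h : W `<=` V i) (h1 : W1 `<=` V i) (h2 : W1 `<=` W) (x : F W) :
  p i (inside h1) (res F h2 x) = res G h2 (p i (inside h) x).
Proof. exact: ((hom_valP (s i)).2 (inside h) (inside h1)). Qed.

Lemma glue_cover W : W `<=` U -> W `<=` \bigcup_i (oI W (V i)).
Proof. by move=> h z Wz; have [i _ Vz] := cU (h z Wz); exists i. Qed.

Lemma glue_ex W (h : W `<=` U) (x : F W) :
  exists y : G W, forall i, res G (@oIl _ W (V i)) y =
    p i (inside (@oIr _ W (V i))) (res F (@oIl _ W (V i)) x).
Proof.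
have [|y [yE _]] := @sheafP X G W I (fun i => oI W (V i))
    (fun i => @oIl _ W (V i)) (glue_cover h)
    (fun i => p i (inside (@oIr _ W (V i)))
      (res F (@oIl _ W (V i)) x)); last by exists y.
move=> i j; set W1 := oI _ _.
have hi : W1 `<=` V i by move=> z [[]].
have hj : W1 `<=` V j by move=> z [_ []].
rewrite -(glue_nat _ hi) -(glue_nat _ hj) (glue_compat hi hj).
have hW : W1 `<=` W by move=> z [[]].
by rewrite !(res_comp _ _ hW).
Qed.

Definition glue : hom_ambient U :=
  fun D x => sval (cid (glue_ex (proj2_sig D) x)).

Lemma glueE (D : opens_in U) (x : F (sval D)) i (h : oI (sval D) (V i) `<=` sval D)
    (h' : oI (sval D) (V i) `<=` V i) :
  res G h ((glue : hom_ambient U) D x) = p i (inside h') (res F h x).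
Proof.
rewrite /glue; case: cid => y /= yE.
rewrite (res_irr _ (@oIl _ _ _)) yE (res_irr _ h).
by rewrite (hom_val_irr _ _ h').
Qed.

Lemma glue_is_hom : is_hom glue.
Proof.
split=> [D x y|D E h x].
  apply: (sheaf_sep (hV := fun i => @oIl _ _ (V i)) (glue_cover (proj2_sig D))).
  move=> i; rewrite raddfB !(glueE _ _ (@oIr _ _ _)) raddfB.
  by rewrite ((hom_valP (s i)).1 (inside (@oIr _ (sval D) (V i)))).
apply: (sheaf_sep (hV := fun i => @oIl _ _ (V i)) (glue_cover (proj2_sig E))).
move=> i; rewrite (glueE _ _ (@oIr _ _ _)).
have h1 : oI (sval E) (V i) `<=` sval D by apply: subset_trans h; exact: oIl.
have h2 : oI (sval E) (V i) `<=` oI (sval D) (V i).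
  by move=> z [Ez Vz]; split => //; exact: h.
rewrite !(res_comp _ _ h1) -(res_comp (@oIl _ _ _) h2) -[RHS](res_comp (@oIl _ _ _) h2).
by rewrite (glueE _ _ (@oIr _ _ _)) (glue_nat (@oIr _ _ _)).
Qed.

End Gluing.

Fact hom_is_sheaf : is_sheaf hom_presheaf.
Proof.
move=> U I V hV cU s sc.
have gP : glue cU sc \in hom_group U by apply/asboolP; exact: glue_is_hom.
exists (exist (fun phi => phi \in hom_group U) (glue cU sc) gP); split=> [i|u uE].
  apply: val_inj; apply: dprodP => -[W hW]; apply: dprodP => x.
  pose D : opens_in U := opens_in_sub (hV i) (inside hW).
  rewrite -[LHS]/((glue cU sc : hom_ambient U) D x).
  rewrite -[RHS]/((val (s i) : hom_ambient (V i)) (inside hW) x).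
  apply: (sheaf_sep (hV := fun j => @oIl _ W (V j)) (glue_cover cU (proj2_sig D))).
  move=> j; rewrite (glueE cU sc (D := D) x (@oIl _ _ _) (@oIr _ _ _)).
  have hj : oI W (V j) `<=` V i := subset_trans (@oIl _ _ _) hW.
  rewrite (glue_compat sc (@oIr _ _ _) hj).
  exact: (glue_nat s hW hj (@oIl _ W (V j))).
apply: val_inj; apply: dprodP => D; apply: dprodP => x /=.
apply: (sheaf_sep (hV := fun j => @oIl _ _ (V j)) (glue_cover cU (proj2_sig D))).
move=> i; rewrite (glueE cU sc x (@oIl _ _ _) (@oIr _ _ _)) -uE /=.
rewrite /hom_ambient_res; set E := opens_in_sub _ _.
by rewrite -((hom_valP u).2 D E).
Qed.

Definition hom_sheaf : sheaf X := Sheaf hom_is_sheaf.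

End HomSheaf.

Section Soft.
Context {X : topologicalType} (F : presheaf X).

Definition local_section : Type := {V : opens X & F V}.

(* The germ of s at x, as the class of all local sections that agree with s on
   a neighbourhood of x; it is empty when x is not in U. *)
Definition germ (U : opens X) (s : F U) (x : X) : set local_section :=
  [set t : local_section | exists (W : opens X) (hU : W `<=` U) (hV : W `<=` tag t),
     W x /\ res F hU s = res F hV (tagged t)].

(* Continuous sections over A of the space of germs; the values of sigma
   outside A are irrelevant. *)
Definition section_over (A : set X) (sigma : X -> set local_section) : Prop :=
  forall x, A x -> exists (U : opens X) (s : F U),
    U x /\ forall y, A y -> U y -> sigma y = germ s y.

Definition soft : Prop := forall A : set X, closed A ->
  forall sigma, section_over A sigma ->
  exists s : F oT, forall x, A x -> sigma x = germ s x.

Definition flabby : Prop := forall (U : opens X) (s : F U),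
  exists t : F oT, res F (@sub_oT _ U) t = s.

End Soft.

Definition fine (X : topologicalType) (F : sheaf X) : Prop :=
  soft (hom_sheaf F F).

Record sheaf_complex (X : topologicalType) := SheafComplex {
  sobj :> nat -> sheaf X;
  sdiff : forall q, sheaf_hom (sobj q) (sobj q.+1);
  sdiffK : forall q (U : opens X) (s : sobj q U),
    sdiff q.+1 U (sdiff q U s) = 0
}.

Section SheafComplexes.
Context {X : topologicalType}.

Definition kernel_sheaf (K : sheaf_complex X) : sheaf X :=
  ker_sheaf (sdiff K 0).

Definition injective_hom (F G : sheaf X) (f : sheaf_hom F G) : Prop :=
  forall U : opens X, injective (f U).

(* The image sheaf consists of the sections that lift locally. *)
Definition exact_at (F G H : sheaf X) (f : sheaf_hom F G) (g : sheaf_hom G H) : Prop :=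
  forall (U : opens X) (t : G U), g U t = 0 <->
    forall x, U x -> exists (V : opens X) (h : V `<=` U),
      V x /\ exists s : F V, f V s = res G h t.

Definition resolution (S : sheaf X) (K : sheaf_complex X) (e : sheaf_hom S (K 0%N)) :
    Prop :=
  [/\ injective_hom e, exact_at e (sdiff K 0)
    & forall q, exact_at (sdiff K q) (sdiff K q.+1)].

Definition flabby_resolution (S : sheaf X) (K : sheaf_complex X)
    (e : sheaf_hom S (K 0%N)) : Prop :=
  resolution e /\ forall q, flabby (K q).

Definition section_complex (K : sheaf_complex X) (U : opens X) : complex :=
  @Complex (fun q => K q U) (fun q => sdiff K q U) (fun q => @sdiffK X K q U).

Fact vanishing_diff (K : sheaf_complex X) (X' : opens X) q (s : K q oT) :
  s \in ker (res (K q) (@sub_oT _ X')) ->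
  sdiff K q oT s \in ker (res (K q.+1) (@sub_oT _ X')).
Proof. by rewrite !kerE -hom_nat => /eqP->; rewrite raddf0. Qed.

Definition vanishing_section_complex (K : sheaf_complex X) (X' : opens X) :
    complex :=
  @subcomplex (section_complex K oT) (fun q => ker (res (K q) (@sub_oT _ X')))
    (@vanishing_diff K X').

End SheafComplexes.

Section Cech.
Context {X : topologicalType} {I : Type} (W : I -> opens X).

Fact cap_open q (a : 'I_q.+1 -> I) : open (\bigcap_j W (a j)).
Proof.
rewrite openE => x Wx; apply: filterS (filter_forall _ (f := fun j => W (a j)) _).
  by move=> y h j _; exact: h.
by move=> j; apply: open_nbhs_nbhs; split; [exact: open_oset|exact: Wx].
Qed.

Definition cap q (a : 'I_q.+1 -> I) : opens X := Opens (cap_open a).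

Definition face q (a : 'I_q.+2 -> I) (v : 'I_q.+2) : 'I_q.+1 -> I :=
  fun j => a (lift v j).

Lemma cap_face q (a : 'I_q.+2 -> I) v : cap a `<=` cap (face a v).
Proof. by move=> x h j _; exact: h. Qed.

Section Cochains.
Context (F : presheaf X).

Definition cochain q : zmodType := dprod (fun a : 'I_q.+1 -> I => F (cap a)).

Definition cech_diff q (s : cochain q) : cochain q.+1 :=
  fun a => \sum_(v < q.+2) res F (@cap_face q a v) (s (face a v)) *~ (-1) ^+ v.

Fact cech_diff_additive q : zmod_morphism (@cech_diff q).
Proof.
move=> x y; apply: dprodP => a; rewrite dprodBE /cech_diff -sumrB.
by apply: eq_bigr => v _; rewrite dprodBE raddfB mulrzBl.
Qed.

HB.instance Definition _ q :=
  GRing.isZmodMorphism.Build (cochain q) (cochain q.+1) (@cech_diff q)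
    (@cech_diff_additive q).

Lemma face_face q (a : 'I_q.+3 -> I) (v : 'I_q.+3) (u : 'I_q.+2)
    (v' : 'I_q.+3) (u' : 'I_q.+2) :
  (v <= u)%N -> v' = u.+1 :> nat -> u' = v :> nat ->
  face (face a v) u = face (face a v') u'.
Proof.
move=> vu v'E u'E; apply: functional_extensionality_dep => j.
congr (a _); apply: val_inj; rewrite /= v'E u'E /bump; move: vu.
by case: (leqP u j); case: (leqP v j); lia.
Qed.

Lemma cochain_res_eq q (s : cochain q) (a b : 'I_q.+1 -> I) (U : opens X)
    (ha : U `<=` cap a) (hb : U `<=` cap b) :
  a = b -> res F ha (s a) = res F hb (s b).
Proof. by move=> ab; subst b; exact: res_irr. Qed.

Fact cech_diffK q (s : cochain q) : cech_diff (cech_diff s) = 0.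
Proof.
apply: dprodP => a; rewrite dprod0E /cech_diff.
have h v u : cap a `<=` cap (face (face a v) u).
  by move=> x Wx j _; exact: Wx.
under eq_bigr => v _.
  rewrite raddf_sum /= mulrz_suml.
  under eq_bigr => u _.
    rewrite raddfMz /= (res_comp _ _ (h v u)) -mulrzA -exprD.
  over.
over.
rewrite pair_big /= (bigID (fun p : 'I_q.+3 * 'I_q.+2 => (p.1 <= p.2)%N)) /=.
pose up (p : 'I_q.+3 * 'I_q.+2) : 'I_q.+3 * 'I_q.+2 :=
  (inord p.2.+1, inord p.1).
pose down (p : 'I_q.+3 * 'I_q.+2) : 'I_q.+3 * 'I_q.+2 :=
  (inord p.2, inord p.1.-1).
rewrite [X in _ + X](reindex_onto up down) /=; last first.
  move=> [v u] /=; rewrite -ltnNge => uv; move: (ltn_ord v) (ltn_ord u) => vq uq.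
  by congr pair; apply: val_inj; rewrite /= !inordK; lia.
rewrite [X in _ + X](eq_bigl (fun p : 'I_q.+3 * 'I_q.+2 => (p.1 <= p.2)%N));
    last first.
  move=> [v u] /=; move: (ltn_ord v) (ltn_ord u) => vq uq.
  have u1 : (inord u.+1 : 'I_q.+3) = u.+1 :> nat by rewrite inordK.
  rewrite u1; case: (leqP v u) => vu.
    have v1 : (inord v : 'I_q.+2) = v :> nat by rewrite inordK; lia.
    rewrite v1 -ltnNge ltnS vu /=; apply/eqP; congr pair; apply: val_inj.
      by rewrite /= inordK v1; lia.
    by rewrite /= u1 /= inordK; lia.
  apply/negbTE/negP => /andP[h1 /eqP[]].
  move=> /(congr1 val) /=.
  have h2 : ((inord v : 'I_q.+2) < q.+2)%N by [].
  rewrite inordK; last by lia.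
  by move=> v1; move: h1; rewrite v1 -ltnNge ltnS leqNgt vu.
rewrite -big_split /= big1 // => -[v u] /= vu.
move: (ltn_ord v) (ltn_ord u) => vq uq.
have u1 : (inord u.+1 : 'I_q.+3) = u.+1 :> nat by rewrite inordK.
have v1 : (inord v : 'I_q.+2) = v :> nat by rewrite inordK; lia.
rewrite (cochain_res_eq s (h v u) (h (inord u.+1) (inord v)) (face_face a vu u1 v1)).
by rewrite u1 v1 addnS exprS mulN1r mulrNz addnC addrN.
Qed.

Definition cech_complex : complex := Complex cech_diffK.

Context (I' : set I).

Definition rel_pred q : cochain q -> bool :=
  fun s => `[< forall a : 'I_q.+1 -> I, (forall j, I' (a j)) -> s a = 0 >].

Fact rel_closed q : zmod_closed (@rel_pred q).
Proof.
split=> [|x y]; rewrite !unfold_in; first by apply/asboolP.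
move=> /asboolP x0 /asboolP y0; apply/asboolP => a aI'.
by rewrite dprodBE x0 // y0 // subrr.
Qed.

HB.instance Definition _ q :=
  GRing.isZmodClosed.Build (cochain q) (@rel_pred q) (rel_closed q).

Definition rel_cochains q : zmodClosed (cochain q) :=
  GRing.ZmodClosed.clone (cochain q) (@rel_pred q) _.

Fact rel_diff q (s : cochain q) :
  s \in rel_cochains q -> cech_diff s \in rel_cochains q.+1.
Proof.
rewrite !unfold_in => /asboolP s0; apply/asboolP => a aI'.
rewrite /cech_diff big1 // => v _.
by rewrite s0 ?raddf0 ?mul0rz // => j; exact: aI'.
Qed.

Definition rel_cech_complex : complex :=
  @subcomplex cech_complex rel_cochains rel_diff.

End Cochains.

Section CochainMap.
Context {F G : presheaf X} (f : sheaf_hom F G) (I' : set I).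

Definition cochain_map q (s : cochain F q) : cochain G q :=
  fun a => f (cap a) (s a).

Fact cochain_map_additive q : zmod_morphism (@cochain_map q).
Proof. by move=> x y; apply: dprodP => a; rewrite /cochain_map !dprodBE raddfB. Qed.

HB.instance Definition _ q :=
  GRing.isZmodMorphism.Build (cochain F q) (cochain G q) (@cochain_map q)
    (@cochain_map_additive q).

Fact cochain_map_diff q (s : cochain F q) :
  cochain_map (cech_diff s) = cech_diff (cochain_map s).
Proof.
apply: dprodP => a; rewrite /cochain_map /cech_diff raddf_sum.
by apply: eq_bigr => v _; rewrite raddfMz /= hom_nat.
Qed.

Fact cochain_map_rel q (s : cochain F q) :
  s \in rel_cochains F I' q -> cochain_map s \in rel_cochains G I' q.
Proof.
rewrite !unfold_in => /asboolP s0; apply/asboolP => a aI'.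
by rewrite /cochain_map s0 ?raddf0.
Qed.

Definition rel_cochain_map q :
    {additive rel_cech_complex F I' q -> rel_cech_complex G I' q} :=
  subgrp_map (@cochain_map_rel q).

Fact rel_cochain_map_diff q (s : rel_cech_complex F I' q) :
  rel_cochain_map q.+1 (diff (rel_cech_complex F I') q s)
  = diff (rel_cech_complex G I') q (rel_cochain_map q s).
Proof. by apply: val_inj; exact: cochain_map_diff. Qed.

End CochainMap.

Section CechOfComplex.
Context (K : sheaf_complex X) (I' : set I).

Fact cech_bdifK p r (s : rel_cech_complex (K r) I' p) :
  rel_cochain_map (sdiff K r.+1) I' p (rel_cochain_map (sdiff K r) I' p s) = 0.
Proof. by apply: val_inj; apply: dprodP => a; exact: sdiffK. Qed.

Definition cech_bicomplex : bicomplex :=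
  @Bicomplex (fun p r => rel_cech_complex (K r) I' p)
    (fun p r => diff (rel_cech_complex (K r) I') p)
    (fun p r => rel_cochain_map (sdiff K r) I' p)
    (fun p r => @diffK (rel_cech_complex (K r) I') p)
    cech_bdifK
    (fun p r s => esym (rel_cochain_map_diff (sdiff K r) s)).

Definition cech_total : complex := total cech_bicomplex.

Definition good : Prop :=
  forall (p : nat) (a : 'I_p.+1 -> I) (q : nat), (0 < q)%N ->
    forall x : cohomology (section_complex K (cap a)) q, x = 0.

End CechOfComplex.

Section CanonicalMaps.
Context (K : sheaf_complex X).

Definition restrict q (s : K q oT) : cochain (K q) 0 :=
  fun a => res (K q) (@sub_oT _ (cap a)) s.

Fact restrict_additive q : zmod_morphism (@restrict q).
Proof. by move=> x y; apply: dprodP => a; rewrite dprodBE /restrict raddfB. Qed.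

Fact restrict_rel q (s : K q oT) : restrict s \in rel_cochains (K q) set0 0.
Proof. by apply/asboolP => a /(_ ord0). Qed.

Definition restrict0 q (s : K q oT) : cech_bicomplex K set0 0%N q :=
  exist (fun t => t \in rel_cochains (K q) set0 0) (restrict s) (restrict_rel s).

Fact restrict0_additive q : zmod_morphism (@restrict0 q).
Proof. by move=> x y; apply: val_inj; exact: restrict_additive. Qed.

HB.instance Definition _ q :=
  GRing.isZmodMorphism.Build (K q oT) (cech_bicomplex K set0 0%N q)
    (@restrict0 q) (@restrict0_additive q).

Fact restrict0_del q (s : K q oT) :
  bdel (cech_bicomplex K set0) 0 q (restrict0 s) = 0.
Proof.
apply: val_inj; apply: dprodP => a /=; rewrite /cech_diff big_ord_recl.
rewrite big_ord1 /= expr0 expr1 mulrNz !mulr1z /restrict.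
by rewrite !(res_comp _ _ (@sub_oT _ (cap a))) addrN.
Qed.

Fact restrict0_dif q (s : K q oT) :
  bdif (cech_bicomplex K set0) 0 q (restrict0 s)
  = restrict0 (sdiff K q oT s).
Proof.
by apply: val_inj; apply: dprodP => a; rewrite /= /cochain_map /restrict hom_nat.
Qed.

(* K^q(X) -> C^0(W; K^q), s |-> (s|W_a)_a. *)
Definition section_to_cech : cmap (section_complex K oT) (cech_total K set0) :=
  @edge_p0_cmap (section_complex K oT) (cech_bicomplex K set0)
    (fun q => @restrict0 q) restrict0_del restrict0_dif.

Context (I' : set I).

Fact kernel_dif q (s : rel_cech_complex (kernel_sheaf K) I' q) :
  bdif (cech_bicomplex K I') q 0
    (rel_cochain_map (ker_incl (sdiff K 0)) I' q s) = 0.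
Proof.
apply: val_inj; apply: dprodP => a /=; rewrite /cochain_map /=.
by apply/eqP; exact: (valP ((val s : cochain (kernel_sheaf K) q) a)).
Qed.

Fact kernel_del q (s : rel_cech_complex (kernel_sheaf K) I' q) :
  bdel (cech_bicomplex K I') q 0
    (rel_cochain_map (ker_incl (sdiff K 0)) I' q s)
  = rel_cochain_map (ker_incl (sdiff K 0)) I' q.+1
      (diff (rel_cech_complex (kernel_sheaf K) I') q s).
Proof. by rewrite -rel_cochain_map_diff. Qed.

(* C^q(W, W'; S) -> C^q(W, W'; K^0), induced by the inclusion of S in K^0. *)
Definition kernel_to_cech :
    cmap (rel_cech_complex (kernel_sheaf K) I') (cech_total K I') :=
  @edge_r0_cmap (rel_cech_complex (kernel_sheaf K) I') (cech_bicomplex K I')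
    (fun q => rel_cochain_map (ker_incl (sdiff K 0)) I' q)
    kernel_dif kernel_del.

End CanonicalMaps.

End Cech.

(* Main.v *)
From HB Require Import structures.
Require Import Defs.
From mathcomp Require Import all_boot all_algebra.
From mathcomp Require Import boolp classical_sets functions cardinality.
From mathcomp Require Import topology wochoice zify.

(* Everything is read off double complexes C^p(W, W'; K^r) and the like, in which
   one of the two edge maps into the total complex is a quasi-isomorphism as soon as
   the rows (respectively the columns) are exact.

   Part 1: a Cech cocycle with values in a fine sheaf is a coboundary over each W_i,
   and local primitives are glued by endomorphisms of the sheaf which are 1 near small
   closed sets and 0 away from them; these exist by softness of Hom(K, K).

   Part 2: goodness says that the columns are exact.

   Part 3: use the double complex C^p(W, W'; L^r) of the flabby resolution L.  Its
   rows are exact because exact complexes of flabby sheaves have exact sections, on X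
   and on X' separately.  Its columns are exact provided that W is good for L as well
   as for K; this is seen by computing both H^q(K(U)) and H^q(L(U)), for U = W_a, from
   the Godement resolution G of S over U, through the double complexes
   G^(p+1)(K^r)(U) and G^(p+1)(L^r)(U).  Here the rows of the former are exact by the
   gluing argument of part 1, since endomorphisms of K act on G^p(K) and U is
   paracompact. *)

Set Implicit Arguments.
Unset Strict Implicit.
Unset Printing Implicit Defensive.

Import GRing.Theory Quotient.

Local Open Scope classical_set_scope.
Local Open Scope ring_scope.
Local Open Scope quotient_scope.


(** * The two edge maps of a double complex *)

(** Two local-to-global principles carry the argument, each applied to two complexes. [fine_lift]
    solves d b = c over U when this is possible locally and endomorphisms of a fine sheaf act
    compatibly on source and target; [flabby_complex_exact] treats locally exact complexes of flabby
    sheaves whose first kernel is flabby. Both are applied to Cech cochains, which are made into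
    sheaves on X for this purpose, and to the iterates of the Godement functor G. The Godement
    resolution is taken as the cobar complex of the single functor G instead of a sequence of
    cokernels: functoriality then makes endomorphisms act at every stage, and no quotient has to be
    sheafified. No morphism between K and L is available, so what is carried from K to L is only the
    vanishing of cohomology over the sets W_a, along isomorphisms with the cohomology of total
    complexes. Softness speaks of closed subsets of X, whereas U is only open. Hence endomorphisms
    are always built on all of X, with supports whose closure in X stays inside U. *)

Section CohomologyMaps.
Context {C D : complex}.

Lemma cohomology0P q (x : cohomology C q) :
  x = 0 <-> forall z : cocycle C q, x = \pi z -> coboundary (val z).
Proof.
split=> [x0 z xz|h].
  have : z - 0 \in exact_cocycle C q by rewrite idealrBE -xz x0 raddf0.
  by rewrite subr0 => /asboolP.
have := h (repr x); rewrite reprK => /(_ erefl) hx.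
rewrite -[x]reprK; transitivity (\pi_(cohomology C q) (0 : cocycle C q)).
  by apply/eqP; rewrite -idealrBE subr0; apply/asboolP.
by rewrite raddf0.
Qed.

(** Reduces bijectivity to representatives, so that the double complex arguments handle only
    cocycles and primitives. *)
Lemma coh_map_bij (f : cmap C D) q :
  (forall z, diff D q z = 0 -> exists x, diff C q x = 0 /\ coboundary (z - f q x)) ->
  (forall x, diff C q x = 0 -> coboundary (f q x) -> coboundary x) ->
  bijective (coh_map f q).
Proof.
move=> fs fi.
have inj : injective (coh_map f q).
  move=> x y; rewrite -[x]reprK -[y]reprK.
  move: (repr x) (repr y) => {}x {}y xy.
  apply/eqP; rewrite -idealrBE; apply/asboolP.
  apply: fi; first by apply/eqP; exact: (valP (x - y)).
  move/eqP: xy; rewrite /coh_map /= !quot_mapE -idealrBE -raddfB.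
  by move=> /asboolP.
have surj y : exists x, coh_map f q x = y.
  have [x [dx xy]] := fs (val (repr y)) (eqP (valP (repr y))).
  have kx : x \in ker (diff C q) by rewrite kerE dx.
  exists (\pi_(cohomology C q) (exist (fun x => x \in ker (diff C q)) x kx : cocycle C q)).
  rewrite /coh_map /= quot_mapE -[RHS]reprK; apply/esym/eqP.
  by rewrite -idealrBE; apply/asboolP.
exists (fun y => sval (cid (surj y))) => [x|y]; last by case: cid.
by apply: inj; case: cid.
Qed.

End CohomologyMaps.

Lemma exact_of_cohomology0 (C : complex) q (z : C q.+1) :
  (forall x : cohomology C q.+1, x = 0) -> diff C q.+1 z = 0 ->
  exists y, diff C q y = z.
Proof.
move=> C0 dz; have kz : z \in ker (diff C q.+1) by rewrite kerE dz.
pose z' : cocycle C q.+1 := exist (fun z => z \in ker (diff C q.+1)) z kz.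
have [y _ yE] := (cohomology0P _).1 (C0 (\pi z')) z' erefl.
by exists y.
Qed.

Lemma cohomology0_bij (C D : complex) (f : cmap C D) q : bijective (coh_map f q) ->
  (forall x : cohomology C q, x = 0) <-> (forall y : cohomology D q, y = 0).
Proof.
move=> bf; split=> [C0 y|D0 x].
  by have [g _ fK] := bf; rewrite -(fK y) (C0 (g y)) raddf0.
by apply: (bij_inj bf); rewrite (raddf0 (coh_map f q)); exact: D0.
Qed.

(** Serves zigzags A -> C <- B: two edge maps into one total complex are joined by inverting the
    second. *)
Lemma bij_additive_comp (A B C : zmodType) (f : {additive A -> C}) (g : {additive B -> C}) :
  bijective f -> bijective g -> exists h : {additive A -> B}, bijective h.
Proof.
move=> [f' fK f'K] [g' gK g'K].
have hB : zmod_morphism (g' \o f).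
  by move=> x y; apply: (can_inj gK); rewrite /= (raddfB g) !g'K raddfB.
pose H := GRing.isZmodMorphism.Build A B (g' \o f) hB.
pose h : {additive A -> B} := HB.pack (g' \o f) H.
exists h, (f' \o g) => x /=; first by rewrite g'K fK.
by rewrite f'K gK.
Qed.

Section BicomplexReduction.
Context (B : bicomplex).

(** The transport of [b] along an equality of bidegrees becomes the identity by proof irrelevance,
    see [single_eq]. *)
Definition single q p r (h : (p + r)%N = q) (b : B p r) : tot B q :=
  fun i => match pselect ((p, r) = sval i) with
           | left e => match e in _ = x return B x.1 x.2 with erefl => b end
           | right _ => 0
           end.

Lemma single_eq q p r (h h' : (p + r)%N = q) (b : B p r) :
  single h b (bideg h') = b.
Proof.
rewrite /single; case: pselect => [e|]; last by case.
by rewrite (Prop_irrelevance e erefl).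
Qed.

Lemma single_neq q p r p' r' (h : (p + r)%N = q) (h' : (p' + r')%N = q)
    (b : B p r) : (p, r) <> (p', r') -> single h b (bideg h') = 0.
Proof. by rewrite /single; case: pselect. Qed.

Lemma tot_del_eq0 q (x : tot B q) p r (h : (p + r)%N = q.+1) :
  (forall p' (h' : (p' + r)%N = q), p = p'.+1 -> x (bideg h') = 0) ->
  tot_del x h = 0.
Proof. by case: p h => //= p h x0; rewrite x0 ?raddf0. Qed.

Lemma tot_dif_eq0 q (x : tot B q) p r (h : (p + r)%N = q.+1) :
  (forall r' (h' : (p + r')%N = q), r = r'.+1 -> x (bideg h') = 0) ->
  tot_dif x h = 0.
Proof. by case: r h => //= r h x0; rewrite x0 ?raddf0 ?mul0rz. Qed.

Lemma totP q (x y : tot B q) :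
  (forall p r (h : (p + r)%N = q), x (bideg h) = y (bideg h)) -> x = y.
Proof. by move=> xy; apply: dprodP => -[[p r] h]; exact: xy. Qed.

Lemma tot_diffB q (x y : tot B q) : tot_diff (x - y) = tot_diff x - tot_diff y.
Proof. exact: tot_diff_additive. Qed.

Lemma tot_diffD q (x y : tot B q) : tot_diff (x + y) = tot_diff x + tot_diff y.
Proof. exact: (raddfD (@tot_diff B q)). Qed.

Lemma tot_diffBd q (z : tot B q.+1) (y : tot B q) :
  tot_diff (z - tot_diff y) = tot_diff z.
Proof. by rewrite tot_diffB tot_diffK subr0. Qed.

Section Rows.
Hypothesis rows_exact : forall p r (x : B p.+1 r), bdel B p.+1 r x = 0 ->
  exists y, bdel B p r y = x.

(** Descent on the last column that carries a component. That component is a cocycle of its row,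
    since nothing lies to the right of it; a primitive in column [k] removes it and disturbs only
    column [k] otherwise. The differential of [z] is assumed to vanish only for [p > 0], because
    injectivity of the edge map needs the case where it is a nonzero element of column 0. *)
Lemma reduce_rows_rec k q (z : tot B q.+1) :
  (forall p r (h : (p + r)%N = q.+2), (0 < p)%N -> tot_diff z (bideg h) = 0) ->
  (forall p r (h : (p + r)%N = q.+1), (k < p)%N -> z (bideg h) = 0) ->
  exists y : tot B q, forall p r (h : (p + r)%N = q.+1),
    (0 < p)%N -> (z - tot_diff y) (bideg h) = 0.
Proof.
elim: k z => [|k IH] z dz zk.
  by exists 0 => p r h p0; rewrite raddf0 subr0 zk.
have [kq|qk] := leqP k q; last first.
  by apply: IH => // p r h kp; apply: zk; lia.
have h0 : (k.+1 + (q - k))%N = q.+1 by lia.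
have hy : (k + (q - k))%N = q by lia.
have [y0 y0E] : exists y0, bdel B k (q - k)%N y0 = z (bideg h0).
  apply: rows_exact.
  have h2 : (k.+2 + (q - k))%N = q.+2 by lia.
  have := dz _ _ h2 isT; rewrite tot_diffE (tot_delE _ _ h0) tot_dif_eq0 ?addr0 //.
  by move=> r h _; rewrite zk.
pose y1 := single hy y0.
have [||y yE] := IH (z - tot_diff y1).
- by move=> p r h p0; rewrite tot_diffBd dz.
- move=> p r h; rewrite leq_eqVlt => /orP[/eqP kp|kp]; last first.
    rewrite dprodBE zk // sub0r tot_diffE tot_del_eq0 ?tot_dif_eq0 ?addr0 ?oppr0 //.
      by move=> r' h' _; rewrite /y1 single_neq // => -[]; lia.
    by move=> p' h' pE; rewrite /y1 single_neq // => -[]; lia.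
  subst p; have rE : r = (q - k)%N by lia.
  subst r; rewrite dprodBE tot_diffE (tot_delE _ _ hy) /y1 single_eq y0E.
  rewrite tot_dif_eq0 => [|r h' _]; last by rewrite /y1 single_neq // => -[]; lia.
  by rewrite addr0 (Prop_irrelevance h h0) subrr.
exists (y1 + y) => p r h p0.
by rewrite tot_diffD opprD addrA yE.
Qed.

Lemma reduce_rows q (z : tot B q.+1) :
  (forall p r (h : (p + r)%N = q.+2), (0 < p)%N -> tot_diff z (bideg h) = 0) ->
  exists y : tot B q, forall p r (h : (p + r)%N = q.+1),
    (0 < p)%N -> (z - tot_diff y) (bideg h) = 0.
Proof. by move=> dz; apply: (reduce_rows_rec (k := q.+1)) => // p r h; lia. Qed.

Section Edge.
Context (A : complex) (f : forall q, {additive A q -> B 0%N q}).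
Hypothesis f_del : forall q (x : A q), bdel B 0%N q (f q x) = 0.
Hypothesis f_dif : forall q (x : A q), bdif B 0%N q (f q x) = f q.+1 (diff A q x).
Hypothesis f_inj : forall q (x : A q), f q x = 0 -> x = 0.
Hypothesis f_ker : forall q (y : B 0%N q), bdel B 0%N q y = 0 ->
  exists x, f q x = y.

Lemma edge_p0_totE q (x : A q) (h : (0 + q)%N = q) :
  edge_p0_tot f x (bideg h) = f q x.
Proof. by rewrite /edge_p0_tot /= (Prop_irrelevance (esym h) erefl). Qed.

Lemma edge_p0_liftP q (z : tot B q) :
  (forall p r (h : (p + r)%N = q), (0 < p)%N -> z (bideg h) = 0) ->
  (forall p r (h : (p + r)%N = q.+1), (0 < p)%N -> tot_diff z (bideg h) = 0) ->
  exists x, z = edge_p0_tot f x.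
Proof.
move=> z0 dz; have h1 : (1 + q)%N = q.+1 by lia.
have h0 : (0 + q)%N = q by [].
have := dz _ _ h1 isT; rewrite tot_diffE (tot_delE _ _ h0) tot_dif_eq0 ?addr0.
  move=> /f_ker[x xE]; exists x; apply: totP => -[|p] r h; last by rewrite z0.
  have rq : r = q by [].
  by subst r; rewrite edge_p0_totE xE (Prop_irrelevance h h0).
by move=> r h _; rewrite z0.
Qed.

Lemma edge_p0_tot_inj q (x : A q) : edge_p0_tot f x = 0 -> x = 0.
Proof.
have h0 : (0 + q)%N = q by [].
move=> /(congr1 (fun z : tot B q => z (bideg h0))).
by rewrite edge_p0_totE => /f_inj.
Qed.

(** Surjectivity: a total cocycle is pushed into column 0, where it is killed by [bdel] and so comes
    from [A]. Injectivity: if the image of [x] is D y, it lies in column 0, so [y] can be pushed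
    there without changing D y; then [y] comes from some [u] with d u = x. *)
Theorem edge_p0_bij q : bijective (coh_map (edge_p0_cmap f_del f_dif) q).
Proof.
apply: coh_map_bij => [z dz|x dx] /=.
  have [y yE] : exists y : tot B q, @coboundary (Defs.total B) q y /\
      forall p r (h : (p + r)%N = q), (0 < p)%N -> (z - y) (bideg h) = 0.
    (* In degree 0 the only bidegree is (0, 0), so nothing has to be removed and the coboundary 0
       serves. *)
    case: q z dz => [|q] z dz.
      by exists 0; split=> // p r h; lia.
    have [|y yE] := @reduce_rows q z; first by move=> p r h _; rewrite [tot_diff _]dz.
    by exists (tot_diff y); split=> //; exists y.
  have dy : tot_diff y = 0.
    case: q y {z dz yE} (yE.1) => [|q] y /=; first by move=> ->; rewrite raddf0.
    by move=> [u _ <-]; exact: tot_diffK.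
  have dzy : tot_diff (z - y) = 0 by rewrite tot_diffB [tot_diff z]dz dy subr0.
  have [||x xE] := @edge_p0_liftP q (z - y); first by case: yE.
    by move=> p r h _; rewrite dzy.
  exists x; split; last by rewrite -xE opprB addrC subrK; case: yE.
  by apply: edge_p0_tot_inj; rewrite (edge_p0_diff f_del f_dif) -xE.
case: q x dx => [|q] x dx /=; first exact: edge_p0_tot_inj.
move=> [y _ yE].
have [y' [y'E y'0]] : exists y' : tot B q, tot_diff y' = tot_diff y /\
    forall p r (h : (p + r)%N = q), (0 < p)%N -> y' (bideg h) = 0.
  case: q x dx y yE => [|q] x dx y yE; first by exists y; split=> // p r h; lia.
  have [|w wE] := @reduce_rows q y.
    by move=> [//|p] r h _; rewrite [tot_diff y]yE.
  by exists (y - tot_diff w); split=> //; exact: tot_diffBd.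
have [//||u uE] := @edge_p0_liftP q y'.
  by move=> [//|p] r h _; rewrite y'E [tot_diff y]yE.
exists u => //; apply/eqP; rewrite -subr_eq0; apply/eqP/edge_p0_tot_inj.
by rewrite edge_p0_additive (edge_p0_diff f_del f_dif) -uE y'E [tot_diff y]yE subrr.
Qed.

End Edge.
End Rows.

Section Columns.
Hypothesis columns_exact : forall p r (x : B p r.+1), bdif B p r.+1 x = 0 ->
  exists y, bdif B p r y = x.

Lemma mulrz_sign (V : zmodType) (x : V) p :
  x *~ (-1) ^+ p *~ (-1) ^+ p = x.
Proof. by rewrite -mulrzA -exprMn mulrNN mulr1 expr1n mulr1z. Qed.

Lemma mulrz_sign_eq0 (V : zmodType) (x : V) p : x *~ (-1) ^+ p = 0 -> x = 0.
Proof. by move=> x0; rewrite -(mulrz_sign x p) x0 mul0rz. Qed.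

(** The descent of [reduce_rows_rec] with the roles of the two degrees exchanged; only the sign of
    [bdif] in the total differential is new. *)
Lemma reduce_columns_rec k q (z : tot B q.+1) :
  (forall p r (h : (p + r)%N = q.+2), (0 < r)%N -> tot_diff z (bideg h) = 0) ->
  (forall p r (h : (p + r)%N = q.+1), (k < r)%N -> z (bideg h) = 0) ->
  exists y : tot B q, forall p r (h : (p + r)%N = q.+1),
    (0 < r)%N -> (z - tot_diff y) (bideg h) = 0.
Proof.
elim: k z => [|k IH] z dz zk.
  by exists 0 => p r h p0; rewrite raddf0 subr0 zk.
have [kq|qk] := leqP k q; last first.
  by apply: IH => // p r h kp; apply: zk; lia.
have h0 : ((q - k) + k.+1)%N = q.+1 by lia.
have hy : ((q - k) + k)%N = q by lia.
have [y0 y0E] : exists y0, bdif B (q - k)%N k y0 = z (bideg h0).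
  apply: columns_exact.
  have h2 : ((q - k) + k.+2)%N = q.+2 by lia.
  have := dz _ _ h2 isT.
  rewrite tot_diffE (tot_difE _ _ h0) tot_del_eq0 ?add0r; first exact: mulrz_sign_eq0.
  by move=> r h _; rewrite zk.
(* The sign cancels the one that the total differential puts on [bdif] in column [q - k]. *)
pose y1 := single hy (y0 *~ (-1) ^+ (q - k)).
have [||y yE] := IH (z - tot_diff y1).
- by move=> p r h p0; rewrite tot_diffBd dz.
- move=> p r h; rewrite leq_eqVlt => /orP[/eqP kr|kr]; last first.
    rewrite dprodBE zk // sub0r tot_diffE tot_del_eq0 ?tot_dif_eq0 ?addr0 ?oppr0 //.
      by move=> r' h' _; rewrite /y1 single_neq // => -[]; lia.
    by move=> p' h' pE; rewrite /y1 single_neq // => -[]; lia.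
  subst r; have pE : p = (q - k)%N by lia.
  subst p; rewrite dprodBE tot_diffE (tot_difE _ _ hy) /y1 single_eq.
  rewrite raddfMz mulrz_sign y0E.
  rewrite tot_del_eq0 => [|r h' _]; last by rewrite /y1 single_neq // => -[]; lia.
  by rewrite add0r (Prop_irrelevance h h0) subrr.
exists (y1 + y) => p r h p0.
by rewrite tot_diffD opprD addrA yE.
Qed.

Lemma reduce_columns q (z : tot B q.+1) :
  (forall p r (h : (p + r)%N = q.+2), (0 < r)%N -> tot_diff z (bideg h) = 0) ->
  exists y : tot B q, forall p r (h : (p + r)%N = q.+1),
    (0 < r)%N -> (z - tot_diff y) (bideg h) = 0.
Proof. by move=> dz; apply: (reduce_columns_rec (k := q.+1)) => // p r h; lia. Qed.

Section Edge.
Context (A : complex) (f : forall q, {additive A q -> B q 0%N}).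
Hypothesis f_dif : forall q (x : A q), bdif B q 0 (f q x) = 0.
Hypothesis f_del : forall q (x : A q), bdel B q 0 (f q x) = f q.+1 (diff A q x).
Hypothesis f_inj : forall q (x : A q), f q x = 0 -> x = 0.
Hypothesis f_ker : forall q (y : B q 0%N), bdif B q 0 y = 0 ->
  exists x, f q x = y.

Lemma edge_r0_totE q (x : A q) (h : (q + 0)%N = q) :
  edge_r0_tot f x (bideg h) = f q x.
Proof. by rewrite /edge_r0_tot /= (Prop_irrelevance (etrans _ _) erefl). Qed.

Lemma edge_r0_liftP q (z : tot B q) :
  (forall p r (h : (p + r)%N = q), (0 < r)%N -> z (bideg h) = 0) ->
  (forall p r (h : (p + r)%N = q.+1), (0 < r)%N -> tot_diff z (bideg h) = 0) ->
  exists x, z = edge_r0_tot f x.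
Proof.
move=> z0 dz; have h1 : (q + 1)%N = q.+1 by lia.
have h0 : (q + 0)%N = q by lia.
have := dz _ _ h1 isT; rewrite tot_diffE (tot_difE _ _ h0) tot_del_eq0 ?add0r.
  move=> /mulrz_sign_eq0/f_ker[x xE]; exists x; apply: totP => p [|r] h.
    have pq : p = q by lia.
    by subst p; rewrite edge_r0_totE xE (Prop_irrelevance h h0).
  by rewrite z0.
by move=> r h _; rewrite z0.
Qed.

Lemma edge_r0_tot_inj q (x : A q) : edge_r0_tot f x = 0 -> x = 0.
Proof.
have h0 : (q + 0)%N = q by lia.
move=> /(congr1 (fun z : tot B q => z (bideg h0))).
by rewrite edge_r0_totE => /f_inj.
Qed.

Theorem edge_r0_bij q : bijective (coh_map (edge_r0_cmap f_dif f_del) q).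
Proof.
apply: coh_map_bij => [z dz|x dx] /=.
  have [y yE] : exists y : tot B q, @coboundary (Defs.total B) q y /\
      forall p r (h : (p + r)%N = q), (0 < r)%N -> (z - y) (bideg h) = 0.
    case: q z dz => [|q] z dz.
      by exists 0; split=> // p r h; lia.
    have [|y yE] := @reduce_columns q z; first by move=> p r h _; rewrite [tot_diff _]dz.
    by exists (tot_diff y); split=> //; exists y.
  have dy : tot_diff y = 0.
    case: q y {z dz yE} (yE.1) => [|q] y /=; first by move=> ->; rewrite raddf0.
    by move=> [u _ <-]; exact: tot_diffK.
  have dzy : tot_diff (z - y) = 0 by rewrite tot_diffB [tot_diff z]dz dy subr0.
  have [||x xE] := @edge_r0_liftP q (z - y); first by case: yE.
    by move=> p r h _; rewrite dzy.
  exists x; split; last by rewrite -xE opprB addrC subrK; case: yE.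
  by apply: edge_r0_tot_inj; rewrite (edge_r0_diff f_dif f_del) -xE.
case: q x dx => [|q] x dx /=; first exact: edge_r0_tot_inj.
move=> [y _ yE].
have [y' [y'E y'0]] : exists y' : tot B q, tot_diff y' = tot_diff y /\
    forall p r (h : (p + r)%N = q), (0 < r)%N -> y' (bideg h) = 0.
  case: q x dx y yE => [|q] x dx y yE; first by exists y; split=> // p r h; lia.
  have [|w wE] := @reduce_columns q y.
    by move=> p [//|r] h _; rewrite [tot_diff y]yE.
  by exists (y - tot_diff w); split=> //; exact: tot_diffBd.
have [//||u uE] := @edge_r0_liftP q y'.
  by move=> p [//|r] h _; rewrite y'E [tot_diff y]yE.
exists u => //; apply/eqP; rewrite -subr_eq0; apply/eqP/edge_r0_tot_inj.
by rewrite edge_r0_additive (edge_r0_diff f_dif f_del) -uE y'E [tot_diff y]yE subrr.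
Qed.

End Edge.
End Columns.
End BicomplexReduction.

(** * Shrinking coverings *)

Section ParacompactOpens.
Context {X : topologicalType}.
Implicit Types (x : X) (U V N : opens X).

Definition locally_finite_on U (J : Type) (G : J -> opens X) : Prop :=
  forall x, U x -> exists2 N : opens X, N x & finite_set [set j | G j `&` N !=set0].

(** The covering property of the subspace [U], phrased with open subsets of [X] so that sheaves on
    [X] can be evaluated on the members of the families. *)
Definition paracompact_on U : Prop :=
  forall (I : Type) (F : I -> opens X), U `<=` \bigcup_i F i ->
  exists (J : Type) (G : J -> opens X),
    [/\ forall j, G j `<=` U, U `<=` \bigcup_j G j, locally_finite_on U G
      & forall j, exists i, G j `<=` F i].

Lemma nbhs_opens x (A : set X) : nbhs x A -> exists2 N : opens X, N x & N `<=` A.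
Proof. by rewrite nbhsE => -[B [oB Bx] BA]; exists (Opens oB). Qed.

Lemma opens_nbhs x U : U x -> nbhs x U.
Proof. by move=> Ux; apply: open_nbhs_nbhs; split => //; exact: open_oset. Qed.

Lemma nbhs_all x (A : set X) : (forall y, A y) -> nbhs x A.
Proof. by move=> h; apply: (filterS (P := setT)) => //; exact: filterT. Qed.

Lemma nbhs_finite_bigcap x (J : Type) (D : set J) (A : J -> set X) :
  finite_set D -> (forall j, D j -> nbhs x (A j)) -> nbhs x (\bigcap_(j in D) A j).
Proof.
move=> /(@finite_seqP {classic J})[s ->]; elim: s => [|j s IH] DA.
  by apply: nbhs_all => y j; rewrite /= in_nil.
apply: (filterS _ (filterI (DA j _) (IH _))) => [y [yj ys] k| |k ks].
- by rewrite /= inE => /orP[/eqP->//|ks]; exact: ys.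
- by rewrite /= inE eqxx.
- by apply: DA; rewrite /= inE (ks : k \in s) orbT.
Qed.

Lemma paracompact_oT : paracompact X -> paracompact_on oT.
Proof.
move=> [_ pX] I F cF; have [|J [G [[oG cG] lG GF]]] := pX I (fun i => F i).
  split=> [i|]; first exact: open_oset.
  by apply/seteqP; split=> // x _; have [i _ Fx] := cF x Logic.I; exists i.
exists J, (fun j => Opens (oG j)); split=> //.
  by move=> x _; have : cover setT G x by rewrite cG.
move=> x _; have [N /nbhs_opens[N' N'x N'N] fN] := lG x; exists N' => //.
by apply: sub_finite_set fN => j [y [Gy Ny]]; exists y; split=> //; exact: N'N.
Qed.

Lemma paracompact_set_type U : paracompact (set_type U) -> paracompact_on U.
Proof.
move=> [_ pU] I F cF.
have [|J [G [[oG cG] lG GF]]] := pU I (fun i => set_val @^-1` F i).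
  split=> [i|]; first by exists (F i) => //; exact: open_oset.
  apply/seteqP; split=> // x _; have [i _ Fx] := cF _ (set_valP x).
  by exists i.
have oE (A : set (set_type U)) : open A ->
    exists B : opens X, A = set_val @^-1` B.
  by move=> [B oB BA]; exists (Opens oB).
pose H j : opens X := oI (sval (cid (oE _ (oG j)))) U.
have HG j (x : set_type U) : H j (set_val x) <-> G j x.
  rewrite /H; case: cid => B /= GB; rewrite GB; split=> [[]//|Bx].
  by split=> //; exact: set_valP.
exists J, H; split=> [j y []//|x Ux|x Ux|j].
- have : cover setT G (SigSub (mem_set Ux)) by rewrite cG.
  by move=> [j _ Gx]; exists j => //; exact/(HG j (SigSub (mem_set Ux))).
- have [N /= + fN] := lG (SigSub (mem_set Ux)).
  rewrite nbhsE => -[N1 [/oE[B BE] N1x] N1N].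
  exists B; first by have : N1 (SigSub (mem_set Ux)) by []; rewrite BE.
  apply: sub_finite_set fN => j [y [Hy By]].
  have Uy : U y by case: Hy.
  exists (SigSub (mem_set Uy)); split; first exact/HG.
  by apply: N1N; rewrite BE.
have [i GFi] := GF j; exists i => y Hy.
have Uy : U y by case: Hy.
by apply: (GFi (SigSub (mem_set Uy))); exact/HG.
Qed.

Lemma closure_disjoint (A : set X) N : A `&` N = set0 -> closure A `&` N = set0.
Proof.
move=> AN; apply/seteqP; split=> // x [/(_ _ (opens_nbhs _))clA Nx].
by have := clA _ Nx; rewrite AN => -[].
Qed.

(** Cover [X] by [V] and by open sets separated from [x], and refine. Only finitely many members
    come near [x], and a small neighbourhood of [x] avoids those not contained in [V]; a point
    outside [V] then has a member around it disjoint from that neighbourhood. *)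
Lemma paracompact_regular : paracompact X -> forall V x, V x ->
  exists2 N : opens X, N x & closure N `<=` V.
Proof.
move=> pX V x Vx; have := pX.1; rewrite open_hausdorff => hX.
pose P (O : opens X) := O `<=` V \/ exists2 A : opens X, A x & A `&` O = set0.
have [|J [G [_ cG lG GF]]] := @paracompact_oT pX {O | P O} sval.
  move=> y _; have [Vy|nVy] := pselect (V y).
    by exists (exist P V (or_introl (fun y h => h))).
  have [|[A B] /= [xA yB] [oA oB /eqP AB]] := hX x y.
    by apply/eqP => xy; apply: nVy; rewrite -xy.
  have PB : P (Opens oB) by right; exists (Opens oA) => //; exact: set_mem.
  by exists (exist P _ PB) => //; exact: set_mem.
have [N Nx fN] := lG x Logic.I.
pose A j : set X := [set y | G j `<=` V \/ ~ G j y].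
have [|N' N'x N'A] := @nbhs_opens x
    (N `&` \bigcap_(j in [set j | G j `&` N !=set0]) A j).
  apply: filterI; first exact: opens_nbhs.
  apply: nbhs_finite_bigcap => // j _.
  have [[O [OV|[B Bx BO]]] /= GO] := GF j.
    by apply: nbhs_all => y; left; exact: subset_trans OV.
  apply: (filterS _ (opens_nbhs Bx)) => y By; right=> /GO Oy.
  by have : (B `&` O) y by []; rewrite BO.
exists N' => // y N'y; apply: contrapT => nVy.
have [j _ Gy] := cG y Logic.I.
have [z [N'z Gz]] := N'y _ (opens_nbhs Gy).
have [Nz /(_ j)[|GV|]] := N'A z N'z; [by exists z|by exact/nVy/GV|by []].
Qed.

(* The members of the shrunk covering are closed in X, and not only in U, because
   the closures in X of the members of the covering are contained in U. *)
Lemma paracompact_shrink U : paracompact X -> paracompact_on U ->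
  forall (I : Type) (F : I -> opens X), U `<=` \bigcup_i F i ->
  exists (J : choiceType) (O : J -> opens X) (C : J -> set X),
    [/\ forall j, exists i, closure (O j) `<=` F i `&` U,
        locally_finite_on U O,
        forall j, closed (C j) /\ C j `<=` O j & U `<=` \bigcup_j C j].
Proof.
move=> pX pU.
have refine (I : Type) (F : I -> opens X) : U `<=` \bigcup_i F i ->
    exists (J : Type) (G : J -> opens X), [/\ U `<=` \bigcup_j G j,
      locally_finite_on U G & forall j, exists i, closure (G j) `<=` F i `&` U].
  move=> cF; pose P (N : opens X) := exists i, closure N `<=` F i `&` U.
  have [|J [G [_ cG lG GP]]] := pU {N | P N} sval.
    move=> x Ux; have [i _ Fx] := cF x Ux.
    have [N Nx NF] := @paracompact_regular pX (oI (F i) U) x (conj Fx Ux).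
    by exists (exist P N (ex_intro _ i NF)).
  exists J, G; split=> // j; have [[N [i NF]] /= GN] := GP j.
  by exists i; apply: subset_trans NF; exact: closure_subset.
move=> I F /refine[J [O [cO lO OF]]].
have [M [P [cP lP PO]]] := refine J O cO.
pose t m := sval (cid (PO m)).
have tP m : closure (P m) `<=` O (t m).
  by rewrite /t; case: cid => j /= h y /h[].
(* The covering is refined twice, and the closures of the finer members are grouped by the [O j]
   chosen to contain them. The union is closed by local finiteness of [P] at points of [U], since
   the closure of [O j] lies in [U]. *)
pose C j := \bigcup_(m in [set m | t m = j]) closure (P m).
have CO j : C j `<=` O j by move=> y [m <- /tP].
exists {classic J}, O, C; split=> //; last first.
  move=> x /cP[m _ Px]; exists (t m) => //; exists m => //.
  exact: subset_closure.
move=> j; split=> // y yC.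
have Uy : U y.
  have [i OFi] := OF j; apply: (OFi y _).2.
  exact: (closure_subset (CO j)).
have [N Ny fN] := lP y Uy.
apply: contrapT => nCy.
pose A m : set X := [set z | t m = j -> ~ closure (P m) z].
have : nbhs y (N `&` \bigcap_(m in [set m | P m `&` N !=set0]) A m).
  apply: filterI; first exact: opens_nbhs.
  apply: nbhs_finite_bigcap => // m _.
  have [tm|ntm] := pselect (t m = j); last first.
    by apply: nbhs_all => z /ntm.
  have cm : open (~` closure (P m)) by rewrite openC; exact: closed_closure.
  apply: (filterS _ (@opens_nbhs y (Opens cm) _)) => [z nz _ //|Pmy].
  by apply: nCy; exists m.
move=> /yC[z [[m tm Pmz] [Nz /(_ m)]]]; apply=> //.
by have [z' ?] := Pmz _ (opens_nbhs Nz); exists z'.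
Qed.

End ParacompactOpens.

(** Corrections by several endomorphisms depend on their order, so lifts over different
    neighbourhoods can agree only if one order rules all index lists. It comes from a well-ordering,
    read on subsets of two and three elements. *)
Lemma exists_total_order (J : eqType) :
  exists leJ : rel J, [/\ total leJ, transitive leJ & antisymmetric leJ].
Proof.
have [R wR] := well_ordering_principle J; exists R.
have min2 x y : exists z, (z == x) || (z == y) /\ R z x /\ R z y.
  have [|z [[zA lz] _]] := wR (mem [:: x; y]); first by exists x; rewrite inE eqxx.
  exists z; move: zA; rewrite !inE => ->; split=> //.
  by split; apply: lz; rewrite !inE eqxx ?orbT.
have tot : total R.
  move=> x y; have [z [/orP[]/eqP-> [h1 h2]]] := min2 x y; first by rewrite h2.
  by rewrite h1 orbT.
have anti : antisymmetric R.
  move=> x y /andP[xy yx].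
  (* Both [x] and [y] are least in the pair, and least elements are unique. *)
  have [|z [_ uz]] := wR (mem [:: x; y]); first by exists x; rewrite inE eqxx.
  have refl a : R a a by case/orP: (tot a a).
  transitivity z; [apply/esym|]; apply: uz; split; rewrite ?inE ?eqxx ?orbT // => t;
    by rewrite !inE => /orP[]/eqP->.
split=> // y x z xy yz.
have [|m [[mA lm] _]] := wR (mem [:: x; y; z]); first by exists x; rewrite inE eqxx.
have refl a : R a a by case/orP: (tot a a).
have [mx my mz] : [/\ R m x, R m y & R m z].
  by split; apply: lm; rewrite !inE eqxx ?orbT.
move: mA; rewrite !inE => /or3P[]/eqP E; subst m => //.
  by have <- : y = x by apply: anti; rewrite xy mx.
have <- : y = z by apply: anti; rewrite yz my.
done.
Qed.

(** * Fine sheaves *)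

Section SheafHoms.
Context {X : topologicalType}.

Lemma sheaf_glue2 (F : sheaf X) (U A B : opens X) (hA : A `<=` U) (hB : B `<=` U)
    (a : F A) (b : F B) : U `<=` A `|` B ->
  res F (@oIl _ A B) a = res F (@oIr _ A B) b ->
  exists t : F U, res F hA t = a /\ res F hB t = b.
Proof.
move=> cU ab; pose V (i : bool) := if i then A else B.
have hV i : V i `<=` U by case: i.
have [||t [tE _]] := @sheafP X F U bool V hV _
    (fun i => if i return F (V i) then a else b).
- by move=> x /cU[Ax|Bx]; [exists true|exists false].
- case=> -[] /=; rewrite ?ab.
  + exact: res_irr.
  + by [].
  + have h (W : opens X) (WA : W `<=` A) (WB : W `<=` B) : res F WA a = res F WB b.
      have WAB : W `<=` oI A B by move=> x Wx; split; [exact: WA|exact: WB].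
      by rewrite -(res_comp (@oIl _ A B) WAB) ab (res_comp _ _ WB).
    by apply/esym; exact: h.
  + exact: res_irr.
exists t; split; [rewrite -(tE true)|rewrite -(tE false)]; exact: res_irr.
Qed.

Section Operations.
Context {F G : presheaf X}.

Definition hom_zero_app (U : opens X) : {additive F U -> G U} := \0.

Fact hom_zero_nat (U V : opens X) (h : V `<=` U) (s : F U) :
  hom_zero_app V (res F h s) = res G h (hom_zero_app U s).
Proof. exact: (esym (raddf0 _)). Qed.

Definition hom_zero : sheaf_hom F G := Defs.Hom hom_zero_nat.

Definition hom_id_app (U : opens X) : {additive F U -> F U} := idfun.

Definition hom_id : sheaf_hom F F := @Defs.Hom X F F hom_id_app (fun _ _ _ _ => erefl).

Context (f g : sheaf_hom F G).

Definition hom_sub_app (U : opens X) (s : F U) : G U := f U s - g U s.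

Fact hom_sub_additive U : zmod_morphism (@hom_sub_app U).
Proof. by move=> s t; rewrite /hom_sub_app (raddfB (f U)) (raddfB (g U)) !opprD addrACA. Qed.

HB.instance Definition _ U :=
  GRing.isZmodMorphism.Build (F U) (G U) (@hom_sub_app U) (@hom_sub_additive U).

Fact hom_sub_nat (U V : opens X) (h : V `<=` U) (s : F U) :
  hom_sub_app (res F h s) = res G h (hom_sub_app s).
Proof. by rewrite /hom_sub_app !hom_nat (raddfB (res G h)). Qed.

Definition hom_sub : sheaf_hom F G := @Defs.Hom X F G (fun U => @hom_sub_app U) hom_sub_nat.

End Operations.

Definition agree_on (F G : presheaf X) (U : opens X) (f g : sheaf_hom F G) :=
  forall V : opens X, V `<=` U -> forall s, f V s = g V s.

Lemma germ_res (F : presheaf X) (U V : opens X) (h : V `<=` U) (s : F U) x :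
  V x -> germ (res F h s) x = germ s x.
Proof.
move=> Vx; apply/seteqP; split=> -[W t] /= [N [hU [hV [Nx st]]]].
  exists N, (subset_trans hU h), hV; split=> //.
  by rewrite -st (res_comp _ _ (subset_trans hU h)).
pose N' := oI N V; have hN : N' `<=` N by exact: oIl.
exists N', (@oIr _ N V), (subset_trans hN hV); split=> //=.
rewrite (res_comp _ _ (subset_trans hN hU)).
by rewrite -(res_comp hU hN) st (res_comp _ _ (subset_trans hN hV)).
Qed.

Lemma germ_self (F : presheaf X) (U : opens X) (s : F U) x :
  U x -> germ s x (existT _ U s).
Proof. by move=> Ux; exists U, (fun y h => h), (fun y h => h). Qed.

Section Bump.
Context (K : sheaf X).

Definition hom_section_app (phi : hom_sections K K oT) (U : opens X) (s : K U) : K U :=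
  (val phi : hom_ambient K K oT) (inside (@sub_oT _ U)) s.

Fact hom_section_additive phi U : zmod_morphism (@hom_section_app phi U).
Proof. exact: ((hom_valP phi).1 (inside (@sub_oT _ U))). Qed.

HB.instance Definition _ phi U :=
  GRing.isZmodMorphism.Build (K U) (K U) (@hom_section_app phi U)
    (@hom_section_additive phi U).

Fact hom_section_nat phi (U V : opens X) (h : V `<=` U) (s : K U) :
  hom_section_app phi (res K h s) = res K h (hom_section_app phi s).
Proof. exact: ((hom_valP phi).2 (inside (@sub_oT _ U)) (inside (@sub_oT _ V))). Qed.

Definition hom_section (phi : hom_sections K K oT) : sheaf_hom K K :=
  @Defs.Hom X K K (fun U => @hom_section_app phi U) (hom_section_nat phi).

Definition section_hom (f : sheaf_hom K K) (U : opens X) : hom_ambient K K U :=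
  fun V s => f (sval V) s.

Fact section_hom_proof f U : @section_hom f U \in hom_group K K U.
Proof.
apply/asboolP; split=> [V|D E h s]; first exact: (raddfB (f (sval V))).
exact: hom_nat.
Qed.

Definition section_of_hom f U : hom_sheaf K K U :=
  exist (fun phi => phi \in hom_group K K U) (@section_hom f U) (section_hom_proof f U).

(** A germ is a set of local sections. The section given by [f] belongs to its own germ, hence to
    that of [phi], which unfolds to agreement near [x]. *)
Lemma germ_agree phi f x :
  germ (section_of_hom f oT) x = germ (phi : hom_sheaf K K oT) x ->
  exists2 N : opens X, N x & agree_on N (hom_section phi) f.
Proof.
move=> /(congr1 (fun A : set _ => A (existT _ oT (section_of_hom f oT)))).
have -> : germ (section_of_hom f oT) x (existT _ oT (section_of_hom f oT)) = True.
  by apply/propext; split=> // _; exact: germ_self.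
move=> /esym; rewrite propeqE => -[_ /(_ Logic.I)[N [h1 [h2 [Nx /(congr1 val) E]]]]].
exists N => // V VN s.
move/(congr1 (fun p : hom_ambient K K N => p (inside VN) s)): E.
rewrite /= /hom_ambient_res /section_hom /= => E.
rewrite -[RHS]E /hom_section_app; exact: hom_val_irr.
Qed.

(** The germs of the identity on [C] and of zero off [O] form a continuous section over the closed
    set [C] joined with the complement of [O], because [O] and the complement of [C] are open and
    isolate the two pieces. Softness extends it to [X]. *)
Lemma fine_bump (C : set X) (O : opens X) : fine K -> closed C -> C `<=` O ->
  exists psi : sheaf_hom K K,
    (forall V : opens X, V `&` O = set0 -> agree_on V psi hom_zero) /\
    forall x, C x -> exists2 N : opens X, N x & agree_on N psi hom_id.
Proof.
move=> fK cC CO.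
pose sigma y := if pselect (O y) then germ (section_of_hom hom_id oT) y
  else germ (section_of_hom hom_zero oT) y.
have nC : open (~` C) by rewrite openC.
have [||phi phiE] := fK (C `|` ~` O) _ sigma.
- by apply: closedU => //; rewrite closedC; exact: open_oset.
- move=> x [Cx|nOx].
    exists O, (res (hom_sheaf K K) (@sub_oT _ O) (section_of_hom hom_id oT)).
    split=> [|y Ay Oy]; first exact: CO.
    by rewrite germ_res // /sigma; case: pselect.
  exists (Opens nC), (res (hom_sheaf K K) (@sub_oT _ (Opens nC))
    (section_of_hom hom_zero oT)).
  split=> [Cx|y [//|nOy] nCy]; first by apply: nOx; exact: CO.
  by rewrite germ_res // /sigma; case: pselect.
exists (hom_section phi); split=> [V VO W WV s|x Cx]; last first.
  apply: germ_agree; rewrite -phiE; last by left.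
  by rewrite /sigma; case: pselect => // nOx; have := CO x Cx.
(* Equality of germs gives vanishing near each point of [W]; separatedness of [K] turns it into
   vanishing on [W]. *)
have loc (x : {x | W x}) : exists2 N : opens X, N (sval x) &
    agree_on N (hom_section phi) hom_zero.
  case: x => x Wx; apply: germ_agree.
  have nOx : ~ O x.
    move=> Ox; have : (V `&` O) x by split=> //; exact: WV.
    by rewrite VO.
  rewrite /= -phiE; last by right.
  by rewrite /sigma; case: pselect.
pose N x := oI (s2val (cid2 (loc x))) W.
have NW x : N x `<=` W by exact: oIr.
have N0 x : agree_on (N x) (hom_section phi) hom_zero.
  by rewrite /N; case: cid2 => M /= _ M0 V' V'N; apply: M0 => y /V'N[].
apply: (sheaf_sep (hV := NW)) => [x Wx|x].
  by exists (exist _ x Wx) => //; rewrite /N; case: cid2 => M /= Mx _.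
by rewrite -!hom_nat (N0 x).
Qed.

End Bump.
End SheafHoms.

(** * Gluing local lifts with endomorphisms of a fine sheaf *)

Section FineLift.
Context {X : topologicalType} {K T T' : sheaf X} (d : sheaf_hom T T').
Context (act : sheaf_hom K K -> sheaf_hom T T).
Context (act' : sheaf_hom K K -> sheaf_hom T' T').
Hypothesis act_d : forall psi U s, d U (act psi U s) = act' psi U (d U s).
Hypothesis act_local : forall U phi psi,
  agree_on U phi psi -> agree_on U (act phi) (act psi).
Hypothesis act_local' : forall U phi psi,
  agree_on U phi psi -> agree_on U (act' phi) (act' psi).
Hypothesis act0 : forall U s, act hom_zero U s = 0.
Hypothesis act0' : forall U s, act' hom_zero U s = 0.
Hypothesis act1' : forall U s, act' hom_id U s = s.

Section Gluing.
Context (U : opens X) (c : T' U) (J : choiceType) (O : J -> opens X).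
Context (psi : J -> sheaf_hom K K) (e : J -> T U).
Hypothesis psi_supp : forall j (V : opens X),
  V `&` O j = set0 -> agree_on V (psi j) hom_zero.
Hypothesis e_supp : forall j (V : opens X) (h : V `<=` U),
  V `&` O j = set0 -> res T h (e j) = 0.
Hypothesis e_d : forall j, d U (e j) = act' (psi j) U c.

(** Here [e k] stands for psi_k applied to a local lift and extended by zero to [U]. The head of the
    list is the correction made last. *)
Fixpoint partial_lift (l : seq J) : T U :=
  if l is k :: l' then
    e k + (partial_lift l' - act (psi k) U (partial_lift l'))
  else 0.

Lemma partial_lift_cons k l :
  c - d U (partial_lift (k :: l)) =
  c - d U (partial_lift l) - act' (psi k) U (c - d U (partial_lift l)).
Proof.
rewrite /= (raddfD (d U)) (raddfB (d U)) e_d act_d (raddfB (act' (psi k) U)).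
by rewrite !opprD !opprK [RHS]addrACA [LHS]addrA.
Qed.

(** The correction by [j] multiplies the error by 1 - psi_j, which is zero on [N]; the later
    corrections act on the error and keep it zero there. *)
Lemma partial_lift_eq (N : opens X) (h : N `<=` U) j l :
  j \in l -> agree_on N (psi j) hom_id ->
  res T' h (c - d U (partial_lift l)) = 0.
Proof.
move=> + jN; elim: l => // k l IH; rewrite inE partial_lift_cons raddfB.
case/orP => [/eqP<-|/IH kl]; rewrite -hom_nat; last by rewrite kl raddf0 subr0.
by rewrite (act_local' jN) // act1' subrr.
Qed.

(** If [O k] misses [N], both [e k] and the action of psi_k vanish on [N], so the correction by [k]
    changes nothing there. *)
Lemma partial_lift_filter (N : opens X) (h : N `<=` U) l :
  res T h (partial_lift l)
  = res T h (partial_lift [seq j <- l | `[< O j `&` N !=set0 >]]).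
Proof.
elim: l => //= k l IH; case: asboolP => kN /=; rewrite !raddfD !raddfN -!hom_nat.
  by rewrite IH.
have k0 : N `&` O k = set0.
  apply/seteqP; split=> // y [Ny Oy]; apply: kN; by exists y.
by rewrite e_supp // (act_local (psi_supp k0)) // act0 subr0 add0r.
Qed.

Hypothesis O_finite : locally_finite_on U O.
Hypothesis psi_one : forall x, U x ->
  exists2 j, O j x & exists2 N : opens X, N x & agree_on N (psi j) hom_id.

(** Around each point a neighbourhood meets finitely many [O j]; correcting along the sorted list of
    their indices leaves no error, since one psi_j is the identity nearby. *)
Lemma glue_partial_lifts : exists b : T U, d U b = c.
Proof.
have [leJ [totJ trJ asJ]] := exists_total_order J.
have loc (x : {x | U x}) : exists Nl : opens X * seq J,
    [/\ Nl.1 (sval x), Nl.1 `<=` U, uniq Nl.2 /\ sorted leJ Nl.2,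
      forall j, O j `&` Nl.1 !=set0 -> j \in Nl.2
      & forall h : Nl.1 `<=` U, res T' h (c - d U (partial_lift Nl.2)) = 0].
  case: x => x Ux; have [j Ojx [M Mx jM]] := psi_one Ux.
  have [N Nx /finite_seqP[l lE]] := O_finite Ux.
  have inl i : O i `&` N !=set0 -> i \in l.
    by move=> iN; have : [set j | O j `&` N !=set0] i by []; rewrite lE.
  exists (oI U (oI M N), sort leJ (undup l)); split=> /=.
  - by split.
  - by move=> y [].
  - by rewrite sort_uniq undup_uniq; split=> //; exact: sort_sorted.
  - move=> i [y [Oy [_ [_ Ny]]]]; rewrite mem_sort mem_undup; apply: inl.
    by exists y.
  move=> h; apply: (@partial_lift_eq (oI U (oI M N)) h j).
    by rewrite mem_sort mem_undup; apply: inl; exists x.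
  by move=> V VM; apply: jM => y /VM[_ []].
pose N x := (sval (cid (loc x))).1; pose l x := (sval (cid (loc x))).2.
have NP x : [/\ N x (sval x), N x `<=` U, uniq (l x) /\ sorted leJ (l x),
      forall j, O j `&` N x !=set0 -> j \in l x
      & forall h : N x `<=` U, res T' h (c - d U (partial_lift (l x))) = 0].
  by rewrite /N /l; case: cid.
have NU x : N x `<=` U by case: (NP x).
have cN : U `<=` \bigcup_x N x.
  by move=> x Ux; exists (exist _ x Ux) => //; case: (NP (exist _ x Ux)).
have [x y|b [bE _]] := @sheafP X T U _ N NU cN
    (fun x => res T (NU x) (partial_lift (l x))).
  have h : oI (N x) (N y) `<=` U by move=> z [/NU].
  rewrite !(res_comp _ _ h) (partial_lift_filter h) [RHS](partial_lift_filter h).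
  (* After filtering, both lists are the sorted, duplicate-free enumeration of the indices [j] whose
     [O j] meets the overlap, hence they are equal. *)
  congr (res T h (partial_lift _)).
  case: (NP x) (NP y) => _ _ [ux sx] ix _ [_ _ [uy sy] iy _].
  apply: (sorted_eq trJ asJ); rewrite ?sorted_filter //.
  apply: uniq_perm; rewrite ?filter_uniq // => j; rewrite !mem_filter.
  case: asboolP => //= -[z [Oz [Nx Ny]]].
  by rewrite ix ?iy //; exists z.
exists b; apply: (sheaf_sep (hV := NU)) => // x.
rewrite -hom_nat bE hom_nat; apply/esym/eqP; rewrite -subr_eq0 -raddfB.
by case: (NP x) => _ _ _ _ ->.
Qed.

End Gluing.

(* Partition of unity without composing endomorphisms: the local lifts are
   corrected one after the other by b := psi_k b_k + (1 - psi_k) b along a total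
   order of the index set, which multiplies the error c - d b by 1 - psi_k. *)
Theorem fine_lift (U : opens X) (c : T' U) :
  paracompact X -> paracompact_on U -> fine K ->
  (forall x, U x -> exists (V : opens X) (h : V `<=` U),
     V x /\ exists b : T V, d V b = res T' h c) ->
  exists b : T U, d U b = c.
Proof.
move=> pX pU fK loc.
pose P (V : opens X) := exists h : V `<=` U, exists b : T V, d V b = res T' h c.
have [|J [O [C [OF lO CO cC]]]] := paracompact_shrink pX pU (F := fun V : {V | P V} => sval V).
  move=> x Ux; have [V [h [Vx [b bE]]]] := loc x Ux.
  by exists (exist P V (ex_intro _ h (ex_intro _ b bE))).
have bump j : {psi : sheaf_hom K K |
    (forall V : opens X, V `&` O j = set0 -> agree_on V psi hom_zero) /\
    forall x, C j x -> exists2 N : opens X, N x & agree_on N psi hom_id}.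
  by apply: cid; apply: fine_bump => //; have [] := CO j.
pose psi j := sval (bump j).
have psi0 j : forall V : opens X, V `&` O j = set0 -> agree_on V (psi j) hom_zero.
  by rewrite /psi; case: (bump j) => f [].
(* The local lift over [V], multiplied by psi_j, is glued with 0 on the complement [D] of the
   closure of [O j] in [U]; the two cover [U] because that closure lies in [V]. *)
have ext j : exists e : T U,
    (forall (V : opens X) (h : V `<=` U), V `&` O j = set0 -> res T h e = 0) /\
    d U e = act' (psi j) U c.
  have [[V [h [b bE]]] /= OV] := OF j.
  have oD : open (U `&` ~` closure (O j)).
    by apply: openI; [exact: open_oset|rewrite openC; exact: closed_closure].
  pose D := Opens oD.
  have DO : D `&` O j = set0.
    apply/seteqP; split=> // y [[_ nO] Oy]; apply: nO; exact: subset_closure.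
  have DU : D `<=` U by move=> y [].
  have cU : U `<=` V `|` D.
    by move=> y Uy; have [/OV[]|] := pselect (closure (O j) y); [left|right].
  have [|e [eV eD]] := sheaf_glue2 (a := act (psi j) V b) (b := 0 : T D) h DU cU.
    rewrite raddf0 -hom_nat (act_local (psi0 j D DO) (@oIr _ _ _)); exact: act0.
  exists e; split=> [W hW WO|].
    have WD : W `<=` D.
      move=> y Wy; split; first exact: hW.
      move=> clO; have : (closure (O j) `&` W) y by [].
      by rewrite closure_disjoint // setIC.
    by rewrite -(res_comp DU WD) eD raddf0.
  apply: (@sheaf_sep X T' U bool (fun i => if i then V else D)
    (fun i => if i return (if i then V else D) `<=` U then h else DU)).
    by move=> y /cU[]; [exists true|exists false].
  case; rewrite -!hom_nat ?eV ?eD; first by rewrite act_d bE.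
  by rewrite raddf0 (act_local' (psi0 j D DO)) // act0'.
apply: (@glue_partial_lifts U c J O psi (fun j => sval (cid (ext j)))) => //.
- by move=> j; case: cid => e /= [].
- by move=> j; case: cid => e /= [].
move=> x Ux; have [j _ Cx] := cC x Ux; have [_ CjO] := CO j.
exists j; first exact: CjO.
by rewrite /psi; case: (bump j) => f /= [_]; exact.
Qed.

End FineLift.

(** * Flabby sheaves *)

Section Flabby.
Context {X : topologicalType}.

(** Flabbiness of the kernel sheaf of [f], restricted to [Omega]. *)
Definition flabby_kernel (Omega : opens X) (F G : sheaf X) (f : sheaf_hom F G) :=
  forall (V : opens X) (h : V `<=` Omega) (s : F V), f V s = 0 ->
  exists t : F Omega, f Omega t = 0 /\ res F h t = s.

Definition locally_lifts (F G : sheaf X) (f : sheaf_hom F G) (U : opens X) (c : G U) :=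
  forall x, U x -> exists (V : opens X) (h : V `<=` U),
    V x /\ exists b : F V, f V b = res G h c.

Section Lift.
Context {F G : sheaf X} (f : sheaf_hom F G) (Omega U : opens X) (c : G U).
Hypothesis kf : flabby_kernel Omega f.
Hypothesis UO : U `<=` Omega.
Hypothesis loc : locally_lifts f c.

Record partial_lifting := PartialLifting {
  pdom : opens X;
  pdom_sub : pdom `<=` U;
  plift : F pdom;
  plift_eq : f pdom plift = res G pdom_sub c
}.

Definition extends (p p' : partial_lifting) : Prop :=
  exists h : pdom p `<=` pdom p', res F h (plift p') = plift p.

Lemma chain_bound (C : set partial_lifting) :
  (forall p p', C p -> C p' -> extends p p' \/ extends p' p) ->
  exists q, forall p, C p -> extends p q.
Proof.
move=> chC; pose V (p : {p | C p}) := pdom (sval p).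
have oV : open (\bigcup_p V p) by apply: bigcup_open => p _; exact: open_oset.
pose W := Opens oV.
have VW p : V p `<=` W by move=> x Vx; exists p.
have WU : W `<=` U by move=> x [p _]; exact: pdom_sub.
have [//||b [bE _]] := @sheafP X F W _ V VW _ (fun p => plift (sval p)).
  move=> [p Cp] [p' Cp']; rewrite /V /=.
  have [[h <-]|[h <-]] := chC p p' Cp Cp'.
    by rewrite (res_comp _ _ (subset_trans (@oIl _ _ _) h)); exact: res_irr.
  by rewrite (res_comp _ _ (subset_trans (@oIr _ _ _) h)); exact: res_irr.
have bc : f W b = res G WU c.
  apply: (sheaf_sep (hV := VW)) => // p.
  rewrite -hom_nat bE plift_eq (res_comp _ _ (subset_trans (VW p) WU)).
  exact: res_irr.
exists (PartialLifting bc) => p Cp.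
exists (VW (exist _ p Cp)); exact: (bE (exist _ p Cp)).
Qed.

(** Zorn's lemma gives a lift that cannot be extended to a larger open set. If its domain missed a
    point of [U], a local lift near that point could be corrected by a section of the kernel and
    glued to it. *)
Lemma flabby_lift : exists b : F U, f U b = c.
Proof.
pose T : eqType := {classic partial_lifting}.
pose R : rel T := fun p p' => `[< extends p p' >].
have [| |C _ chC|p _ pmax] := @Zorn's_lemma T R predT.
- move=> [V hV b bE] _; apply/asboolP.
  by exists (fun x h => h); rewrite /= res_id.
- move=> p2 p1 p3 _ _ _ /asboolP[h12 e12] /asboolP[h23 e23]; apply/asboolP.
  exists (subset_trans h12 h23); rewrite -e12 -e23.
  by rewrite (res_comp _ _ (subset_trans h12 h23)).
- have [|q qC] := @chain_bound [set p | p \in C].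
    move=> p p' Cp Cp'; have /orP[/asboolP|/asboolP] := wo_chainW chC Cp Cp'; by [left|right].
  by exists q => // p Cp; apply/asboolP; exact: qC.
have Up : U `<=` pdom p.
  move=> x Ux; have [N [hN [Nx [b' b'E]]]] := loc Ux.
  pose VN := oI (pdom p) N.
  have VNU : VN `<=` U by move=> y [_]; exact: hN.
  (* On the overlap the two lifts differ by a section of the kernel; its extension to [Omega]
     corrects [b'] on all of [N]. *)
  have [|t [t0 tE]] := kf (subset_trans VNU UO)
      (s := res F (@oIl _ _ _ : VN `<=` _) (plift p) - res F (@oIr _ _ _ : VN `<=` _) b').
    rewrite (raddfB (f VN)) !hom_nat plift_eq b'E !(res_comp _ _ VNU).
    by rewrite subrr.
  have oW : open (pdom p `|` N) by apply: openU; exact: open_oset.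
  pose W := Opens oW.
  have hp : pdom p `<=` W by move=> y; left.
  have hNW : N `<=` W by move=> y; right.
  have NO : N `<=` Omega := subset_trans hN UO.
  have [//||b [bp bN]] := @sheaf_glue2 X F W _ _ hp hNW (plift p) (b' + res F NO t).
    rewrite (raddfD (res F _)) (res_comp _ _ (subset_trans VNU UO)) tE.
    by rewrite addrC subrK.
  have WU : W `<=` U by move=> y [/pdom_sub|/hN].
  have bc : f W b = res G WU c.
    apply: (@sheaf_sep X G W bool (fun i => if i then pdom p else N)
      (fun i => if i return (if i then pdom p else N) `<=` W then hp else hNW)).
      by move=> y [py|Ny]; [exists true|exists false].
    case; rewrite -hom_nat ?bp ?bN ?plift_eq.
      by rewrite (res_comp _ _ (subset_trans hp WU)); exact: res_irr.
    rewrite (raddfD (f N)) hom_nat t0 raddf0 addr0 b'E.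
    by rewrite (res_comp _ _ (subset_trans hNW WU)); exact: res_irr.
  have /asboolP[h _] : R (PartialLifting bc) p.
    by apply: pmax => //; apply/asboolP; exists hp.
  exact: (h x (hNW x Nx)).
exists (res F Up (plift p)).
by rewrite hom_nat plift_eq (res_comp _ _ (fun y h => h)) res_id.
Qed.

End Lift.

Section FlabbyComplex.
Context (M : sheaf_complex X) (Omega : opens X).
Hypothesis M_flabby : forall q, flabby (M q).
Hypothesis M_ker0 : flabby_kernel Omega (sdiff M 0).
Hypothesis M_exact : forall q (U : opens X) (c : M q.+1 U), U `<=` Omega ->
  sdiff M q.+1 U c = 0 -> locally_lifts (sdiff M q) c.

(** A cocycle over [V] is d b, by [flabby_lift] for the previous kernel; [b] extends to [X] by
    flabbiness, and d of the extension is a cocycle that extends the given one. *)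
Lemma flabby_complex_kernel q : flabby_kernel Omega (sdiff M q).
Proof.
elim: q => // q IH V h s s0.
have [b bE] := flabby_lift IH h (M_exact h s0).
have [t tE] := M_flabby b.
exists (sdiff M q Omega (res (M q) (@sub_oT _ Omega) t)); split; first exact: sdiffK.
rewrite -hom_nat (res_comp _ _ (@sub_oT _ V)).
by rewrite tE.
Qed.

Theorem flabby_complex_exact q (U : opens X) (c : M q.+1 U) : U `<=` Omega ->
  sdiff M q.+1 U c = 0 -> exists b : M q U, sdiff M q U b = c.
Proof.
move=> h c0; apply: (flabby_lift (@flabby_complex_kernel q) h); exact: M_exact.
Qed.

End FlabbyComplex.
End Flabby.

(** * Stalks as groups *)

Section Stalk.
Context {X : topologicalType} (F : presheaf X) (x : X).

Definition open_nbhd := {V : opens X | V x}.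

Definition nbhd_family : zmodType := dprod (fun V : open_nbhd => F (sval V)).

(** The direct limit is realised as a subquotient of a product: families that are compatible with
    restriction from some neighbourhood on, modulo those that vanish from some neighbourhood on. *)
Definition stable_pred : nbhd_family -> bool := fun f =>
  `[< exists V0 : open_nbhd, forall (V : open_nbhd) (h : sval V `<=` sval V0),
      f V = res F h (f V0) >].

Lemma nbhdI (V W : open_nbhd) : exists U : open_nbhd,
  sval U `<=` sval V /\ sval U `<=` sval W.
Proof.
case: V W => [V Vx] [W Wx].
by exists (exist (fun U : opens X => U x) (oI V W) (conj Vx Wx)); split=> y [].
Qed.

Fact stable_closed : zmod_closed stable_pred.
Proof.
split=> [|f g]; rewrite !unfold_in.
  apply/asboolP; exists (exist (fun V : opens X => V x) oT Logic.I) => V h.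
  by rewrite !dprod0E raddf0.
move=> /asboolP[V fV] /asboolP[W gW]; apply/asboolP.
have [U [UV UW]] := nbhdI V W; exists U => N h.
rewrite !dprodBE (raddfB (res F h)) (fV U UV) (gW U UW).
rewrite (fV N (subset_trans h UV)) (gW N (subset_trans h UW)).
by rewrite (res_comp _ _ (subset_trans h UV)) (res_comp _ _ (subset_trans h UW)).
Qed.

HB.instance Definition _ :=
  GRing.isZmodClosed.Build nbhd_family stable_pred stable_closed.

Definition stable_families : zmodClosed nbhd_family :=
  GRing.ZmodClosed.clone nbhd_family stable_pred _.

Definition null_pred : subgrp stable_families -> bool := fun f =>
  `[< exists V0 : open_nbhd, forall V : open_nbhd, sval V `<=` sval V0 ->
      (val f : nbhd_family) V = 0 >].

Fact null_closed : zmod_closed null_pred.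
Proof.
split=> [|f g]; rewrite !unfold_in.
  by apply/asboolP; exists (exist (fun V : opens X => V x) oT Logic.I).
move=> /asboolP[V fV] /asboolP[W gW]; apply/asboolP.
have [U [UV UW]] := nbhdI V W; exists U => N h.
rewrite -[LHS]/((val f : nbhd_family) N - (val g : nbhd_family) N).
by rewrite (fV _ (subset_trans h UV)) (gW _ (subset_trans h UW)) subrr.
Qed.

HB.instance Definition _ :=
  GRing.isZmodClosed.Build (subgrp stable_families) null_pred null_closed.

Definition null_families : zmodClosed (subgrp stable_families) :=
  GRing.ZmodClosed.clone (subgrp stable_families) null_pred _.

Definition stalk : zmodType := {quot null_families}.

(** The value 0 on neighbourhoods not contained in [U] is a filler, invisible in the stalk. *)
Definition germ_family (U : opens X) (s : F U) : nbhd_family := fun V =>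
  if pselect (sval V `<=` U) is left h then res F h s else 0.

Lemma germ_familyE (U : opens X) (s : F U) (V : open_nbhd) (h : sval V `<=` U) :
  germ_family s V = res F h s.
Proof. by rewrite /germ_family; case: pselect => // h'; exact: res_irr. Qed.

Fact germ_family_stable (U : opens X) (Ux : U x) (s : F U) :
  germ_family s \in stable_families.
Proof.
apply/asboolP; exists (exist (fun V : opens X => V x) U Ux) => V h.
by rewrite (germ_familyE s h) (@germ_familyE _ _ (exist _ U Ux) (fun y h => h)) res_id.
Qed.

Definition stable_germ (U : opens X) (Ux : U x) (s : F U) : subgrp stable_families :=
  exist (fun f => f \in stable_families) (germ_family s) (germ_family_stable Ux s).

Definition stalk_germ (U : opens X) (Ux : U x) (s : F U) : stalk :=
  \pi_stalk (stable_germ Ux s).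

Lemma stalk_pi_eq (f g : subgrp stable_families) (V0 : open_nbhd) :
  (forall V : open_nbhd, sval V `<=` sval V0 ->
     (val f : nbhd_family) V = (val g : nbhd_family) V) ->
  \pi_stalk f = \pi_stalk g.
Proof.
move=> fg; apply/eqP; rewrite -idealrBE; apply/asboolP; exists V0 => V h.
rewrite -[LHS]/((val f : nbhd_family) V - (val g : nbhd_family) V).
by rewrite (fg _ h) subrr.
Qed.

Lemma stalk_germB (U : opens X) (Ux : U x) (s t : F U) :
  stalk_germ Ux (s - t) = stalk_germ Ux s - stalk_germ Ux t.
Proof.
rewrite /stalk_germ -raddfB; apply: (@stalk_pi_eq _ _ (exist _ U Ux)) => V /= h.
by rewrite dprodBE !(germ_familyE _ h) (raddfB (res F h)).
Qed.

Lemma stalk_germ_res (U V : opens X) (h : V `<=` U) (Ux : U x) (Vx : V x) (s : F U) :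
  stalk_germ Vx (res F h s) = stalk_germ Ux s.
Proof.
apply: (@stalk_pi_eq _ _ (exist _ V Vx)) => W /= hW.
rewrite (germ_familyE _ hW) (germ_familyE _ (subset_trans hW h)).
exact: res_comp.
Qed.

Lemma stalk_germ_eq0 (U : opens X) (Ux : U x) (s : F U) :
  stalk_germ Ux s = 0 ->
  exists (N : opens X) (h : N `<=` U), N x /\ res F h s = 0.
Proof.
rewrite -[0](raddf0 (\pi_stalk)) => /eqP; rewrite -idealrBE subr0.
move=> /asboolP[V0 sV0]; have [W [WV WU]] := nbhdI V0 (exist _ U Ux).
exists (sval W), WU; split; first by case: (W).
rewrite -(germ_familyE s); exact: (sV0 W WV).
Qed.

Lemma stalk_germ_surj (a : stalk) :
  exists (U : opens X) (Ux : U x) (s : F U), a = stalk_germ Ux s.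
Proof.
rewrite -[a]reprK; move: (repr a) => [f fS]; have /asboolP[[U Ux] fU] := fS.
exists U, Ux, (f (exist _ U Ux)); apply: (@stalk_pi_eq _ _ (exist _ U Ux)) => V /= h.
by rewrite (germ_familyE _ h) (fU V h).
Qed.

Lemma stalk_germ_inj (U V : opens X) (Ux : U x) (Vx : V x) (s : F U) (t : F V) :
  stalk_germ Ux s = stalk_germ Vx t ->
  exists (N : opens X) (hU : N `<=` U) (hV : N `<=` V),
    N x /\ res F hU s = res F hV t.
Proof.
have UVx : oI U V x by split.
rewrite -(stalk_germ_res (@oIl _ U V) Ux UVx) -(stalk_germ_res (@oIr _ U V) Vx UVx).
move=> /eqP; rewrite -subr_eq0 -stalk_germB => /eqP/stalk_germ_eq0[N [h [Nx st]]].
exists N, (subset_trans h (@oIl _ U V)), (subset_trans h (@oIr _ U V)); split=> //.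
move/eqP: st; rewrite (raddfB (res F h)) subr_eq0 => /eqP.
by rewrite (res_comp _ _ (subset_trans h (@oIl _ U V)))
  (res_comp _ _ (subset_trans h (@oIr _ U V))).
Qed.

End Stalk.

Section StalkMap.
Context {X : topologicalType} {F G : presheaf X} (f : sheaf_hom F G) (x : X).

Definition family_map (a : nbhd_family F x) : nbhd_family G x :=
  fun V => f (sval V) (a V).

Fact family_map_additive : zmod_morphism family_map.
Proof. by move=> a b; apply: dprodP => V; rewrite /family_map !dprodBE raddfB. Qed.

HB.instance Definition _ :=
  GRing.isZmodMorphism.Build (nbhd_family F x) (nbhd_family G x) family_map
    family_map_additive.

Fact family_map_stable a :
  a \in stable_families F x -> family_map a \in stable_families G x.
Proof.
move=> /asboolP[V0 aV]; apply/asboolP; exists V0 => V h.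
by rewrite /family_map (aV V h) hom_nat.
Qed.

Fact family_map_null a : a \in null_families F x ->
  subgrp_map family_map_stable a \in null_families G x.
Proof.
move=> /asboolP[V0 aV]; apply/asboolP; exists V0 => V h.
by rewrite /= /family_map aV ?raddf0.
Qed.

Definition stalk_map : {additive stalk F x -> stalk G x} := quot_map family_map_null.

Lemma stalk_map_germ (U : opens X) (Ux : U x) (s : F U) :
  stalk_map (stalk_germ Ux s) = stalk_germ Ux (f U s).
Proof.
rewrite /stalk_map /= quot_mapE.
apply: (@stalk_pi_eq _ _ _ _ _ (exist _ U Ux)) => V /= h.
by rewrite /family_map !(germ_familyE _ h) hom_nat.
Qed.

End StalkMap.

(** * The Godement resolution *)

Section Godement.
Context {X : topologicalType}.

Section Sheaf.
Context (F : presheaf X).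

(** Discontinuous sections: the product of the stalks at the points of [U]. *)
Definition god_sections (U : opens X) : zmodType :=
  dprod (fun x : X => dprod (fun _ : U x => stalk F x)).

Definition god_res (U V : opens X) (h : V `<=` U) (s : god_sections U) :
  god_sections V := fun x Vx => s x (h x Vx).

Fact god_res_additive (U V : opens X) (h : V `<=` U) : zmod_morphism (god_res h).
Proof. by []. Qed.

HB.instance Definition _ (U V : opens X) (h : V `<=` U) :=
  GRing.isZmodMorphism.Build (god_sections U) (god_sections V) (god_res h)
    (god_res_additive h).

Fact god_res_id (U : opens X) (h : U `<=` U) s : god_res h s = s.
Proof.
apply: dprodP => x; apply: dprodP => Ux; rewrite /god_res.
by rewrite (Prop_irrelevance (h x Ux) Ux).
Qed.

Fact god_res_comp (U V W : opens X) (hVU : V `<=` U) (hWV : W `<=` V)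
  (hWU : W `<=` U) s : god_res hWV (god_res hVU s) = god_res hWU s.
Proof.
apply: dprodP => x; apply: dprodP => Wx; rewrite /god_res.
by rewrite (Prop_irrelevance (hVU x (hWV x Wx)) (hWU x Wx)).
Qed.

Definition god_presheaf : presheaf X :=
  @Presheaf X god_sections (fun U V h => @god_res U V h) god_res_id god_res_comp.

Fact god_is_sheaf : is_sheaf god_presheaf.
Proof.
move=> U I V hV cU s sc.
have compat i j x (Vi : V i x) (Vj : V j x) :
    (s i : god_sections _) x Vi = (s j : god_sections _) x Vj.
  have E := congr1 (fun f : god_sections (oI (V i) (V j)) => f x (conj Vi Vj)) (sc i j).
  transitivity (god_res (@oIl _ (V i) (V j)) (s i) (conj Vi Vj)).
    by congr ((s i : god_sections _) x _); exact: Prop_irrelevance.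
  by rewrite [LHS]E; congr ((s j : god_sections _) x _); exact: Prop_irrelevance.
have ex x (Ux : U x) : {i | V i x}.
  by apply: cid; have [i _ Vx] := cU x Ux; exists i.
exists (fun x Ux => (s (sval (ex x Ux)) : god_sections _) x (proj2_sig (ex x Ux))).
split=> [i|t tE]; apply: dprodP => x; apply: dprodP => Ux; first exact: compat.
case: (ex x Ux) => i /= Vx; rewrite -tE /= /god_res.
by rewrite (Prop_irrelevance (hV i x Vx) Ux).
Qed.

Definition god : sheaf X := Sheaf god_is_sheaf.

Lemma god_flabby : flabby god.
Proof.
move=> U s.
exists (fun x _ => if pselect (U x) is left Ux then (s : god_sections U) x Ux else 0).
apply: dprodP => x; apply: dprodP => Ux /=; rewrite /god_res.
by case: pselect => // Ux'; rewrite (Prop_irrelevance Ux' Ux).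
Qed.

Definition god_unit_app (U : opens X) (s : F U) : god U :=
  fun x Ux => stalk_germ Ux s.

Fact god_unit_additive U : zmod_morphism (@god_unit_app U).
Proof.
by move=> s t; apply: dprodP => x; apply: dprodP => Ux; exact: stalk_germB.
Qed.

HB.instance Definition _ U :=
  GRing.isZmodMorphism.Build (F U) (god U) (@god_unit_app U) (@god_unit_additive U).

Fact god_unit_nat (U V : opens X) (h : V `<=` U) (s : F U) :
  god_unit_app (res F h s) = res god h (god_unit_app s).
Proof.
by apply: dprodP => x; apply: dprodP => Vx; exact: stalk_germ_res.
Qed.

Definition god_unit : sheaf_hom F god :=
  @Defs.Hom X F god (fun U => @god_unit_app U) god_unit_nat.

End Sheaf.

Lemma god_unit_eq0 (F : sheaf X) (U : opens X) (s : F U) :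
  god_unit F U s = 0 -> s = 0.
Proof.
move=> s0.
have loc (x : {x | U x}) : exists N : opens X,
    N (sval x) /\ exists h : N `<=` U, res F h s = 0.
  case: x => x Ux; have [|N [h [Nx sN]]] := @stalk_germ_eq0 X F x U Ux s.
    by rewrite -[LHS]/((god_unit F U s : god_sections F U) x Ux) s0.
  by exists N; split=> //; exists h.
pose N x := sval (cid (loc x)).
have NU x : N x `<=` U by rewrite /N; case: cid => M /= [_ []].
apply: (sheaf_sep (hV := NU)) => [x Ux|x].
  by exists (exist _ x Ux) => //; rewrite /N; case: cid => M /= [].
rewrite raddf0; move: (NU x); rewrite /N; case: cid => M /= [_ [h sM]] h'.
by rewrite -sM; exact: res_irr.
Qed.

Section Map.
Context {F G : presheaf X} (f : sheaf_hom F G).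

Definition god_map_app (U : opens X) (s : god F U) : god G U :=
  fun x Ux => stalk_map f x (s x Ux).

Fact god_map_additive U : zmod_morphism (@god_map_app U).
Proof.
by move=> s t; apply: dprodP => x; apply: dprodP => Ux; exact: raddfB.
Qed.

HB.instance Definition _ U :=
  GRing.isZmodMorphism.Build (god F U) (god G U) (@god_map_app U) (@god_map_additive U).

Definition god_map : sheaf_hom (god F) (god G) :=
  @Defs.Hom X (god F) (god G) (fun U => @god_map_app U) (fun _ _ _ _ => erefl).

Lemma god_map_unit (U : opens X) (s : F U) :
  god_map U (god_unit F U s) = god_unit G U (f U s).
Proof.
by apply: dprodP => x; apply: dprodP => Ux; exact: stalk_map_germ.
Qed.

End Map.

Lemma god_map_comm (F G G' H : presheaf X) (f : sheaf_hom F G) (g : sheaf_hom G H)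
    (f' : sheaf_hom F G') (g' : sheaf_hom G' H) :
  (forall U s, g U (f U s) = g' U (f' U s)) ->
  forall U s, god_map g U (god_map f U s) = god_map g' U (god_map f' U s).
Proof.
move=> comm U s; apply: dprodP => x; apply: dprodP => Ux.
rewrite /= /god_map_app.
have [V [Vx [t ->]]] := stalk_germ_surj ((s : god_sections F U) x Ux).
by rewrite !stalk_map_germ comm.
Qed.

Lemma god_map_local (F G : presheaf X) (f g : sheaf_hom F G) (U : opens X) :
  agree_on U f g -> agree_on U (god_map f) (god_map g).
Proof.
move=> fg V VU s; apply: dprodP => x; apply: dprodP => Vx /=; rewrite /god_map_app.
have [W [Wx [t ->]]] := stalk_germ_surj ((s : god_sections F V) x Vx).
have VWx : oI V W x by [].
rewrite -(stalk_germ_res (@oIr _ V W) Wx VWx) !stalk_map_germ fg //.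
exact: subset_trans (@oIl _ V W) VU.
Qed.

Lemma god_map_id (F : presheaf X) (U : opens X) (s : god F U) :
  god_map hom_id U s = s.
Proof.
apply: dprodP => x; apply: dprodP => Ux /=; rewrite /god_map_app.
have [W [Wx [t ->]]] := stalk_germ_surj ((s : god_sections F U) x Ux).
by rewrite stalk_map_germ.
Qed.

Lemma god_map_zero (F G : presheaf X) (U : opens X) (s : god F U) :
  god_map (hom_zero : sheaf_hom F G) U s = 0.
Proof.
apply: dprodP => x; apply: dprodP => Ux /=; rewrite /god_map_app.
have [W [Wx [t ->]]] := stalk_germ_surj ((s : god_sections F U) x Ux).
rewrite stalk_map_germ.
by rewrite -[RHS](subrr (stalk_germ Wx (0 : G W))) -stalk_germB subr0.
Qed.

Lemma god_map_comp0 (F G H : presheaf X) (f : sheaf_hom F G) (g : sheaf_hom G H) :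
  (forall U s, g U (f U s) = 0) ->
  forall U s, god_map g U (god_map f U s) = 0.
Proof.
move=> gf U s; rewrite (god_map_comm (f' := f) (g' := hom_zero)).
  exact: god_map_zero.
by move=> V t; rewrite gf.
Qed.

Lemma god_map_eq0 (F G : presheaf X) (f : sheaf_hom F G) :
  (forall U s, f U s = 0 -> s = 0) ->
  forall U s, god_map f U s = 0 -> s = 0.
Proof.
move=> f0 U s s0; apply: dprodP => x; apply: dprodP => Ux.
have := congr1 (fun t : god_sections G U => t x Ux) s0.
rewrite /= /god_map_app.
have [W [Wx [t ->]]] := stalk_germ_surj ((s : god_sections F U) x Ux).
rewrite stalk_map_germ => /stalk_germ_eq0[N [h [Nx]]].
rewrite -hom_nat => /f0 t0; rewrite -(stalk_germ_res h Wx Nx) t0.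
by rewrite -[RHS](subrr (stalk_germ Nx (0 : F N))) -stalk_germB subr0.
Qed.

Definition locally_exact (F G H : presheaf X) (f : sheaf_hom F G) (g : sheaf_hom G H) :=
  forall (U : opens X) (t : G U), g U t = 0 ->
    forall x, U x -> exists (V : opens X) (h : V `<=` U),
      V x /\ exists s : F V, f V s = res G h t.

(** Lifts are chosen stalk by stalk; as sections are arbitrary families, the choices need no
    compatibility. *)
Lemma god_exact (F G H : presheaf X) (f : sheaf_hom F G) (g : sheaf_hom G H) :
  locally_exact f g ->
  forall U t, god_map g U t = 0 -> exists s, god_map f U s = t.
Proof.
move=> ex U t t0.
have loc x (Ux : U x) : exists a, stalk_map f x a = (t : god_sections G U) x Ux.
  have := congr1 (fun s : god_sections H U => s x Ux) t0.
  rewrite /= /god_map_app.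
  have [W [Wx [b ->]]] := stalk_germ_surj ((t : god_sections G U) x Ux).
  rewrite stalk_map_germ => /stalk_germ_eq0[N [h [Nx]]].
  rewrite -hom_nat => /ex/(_ x Nx)[V [hV [Vx [s sE]]]].
  exists (stalk_germ Vx s); rewrite stalk_map_germ sE.
  by rewrite (stalk_germ_res hV Nx) (stalk_germ_res h Wx).
exists (fun x Ux => sval (cid (loc x Ux))).
by apply: dprodP => x; apply: dprodP => Ux /=; rewrite /god_map_app; case: cid.
Qed.

Fixpoint giter (p : nat) (F : sheaf X) : sheaf X :=
  if p is p'.+1 then god (giter p' F) else F.

Fixpoint giter_map (p : nat) (F G : sheaf X) (f : sheaf_hom F G) :
    sheaf_hom (giter p F) (giter p G) :=
  match p return sheaf_hom (giter p F) (giter p G) with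
  | 0 => f
  | p'.+1 => god_map (giter_map p' f)
  end.

(* The alternating sum of the coface maps of the Godement cosimplicial sheaf. *)
Fixpoint giter_diff (p : nat) (F : sheaf X) : sheaf_hom (giter p F) (giter p.+1 F) :=
  match p return sheaf_hom (giter p F) (giter p.+1 F) with
  | 0 => god_unit F
  | p'.+1 => hom_sub (god_unit (giter p'.+1 F)) (god_map (giter_diff p' F))
  end.

Lemma giter_flabby p (F : sheaf X) : flabby F -> flabby (giter p F).
Proof. by case: p => // p _; exact: god_flabby. Qed.

Lemma giter_diff_nat p (F G : sheaf X) (f : sheaf_hom F G) U s :
  giter_map p.+1 f U (giter_diff p F U s) = giter_diff p G U (giter_map p f U s).
Proof.
elim: p U s => [|p IH] U s; first exact: god_map_unit.
rewrite /= /hom_sub_app (raddfB (god_map (god_map (giter_map p f)) U)).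
congr (_ - _); first exact: god_map_unit.
exact: god_map_comm.
Qed.

(** Write d_(p+1) = u - G(d_p) with u the unit. Naturality of u turns d_(p+2) d_(p+1) into
    G(d_(p+1)) G(d_p), which vanishes by induction. *)
Lemma giter_diffK p (F : sheaf X) U (s : giter p F U) :
  giter_diff p.+1 F U (giter_diff p F U s) = 0.
Proof.
elim: p U s => [|p IH] U s; apply/eqP.
  by rewrite /= /hom_sub_app subr_eq0 god_map_unit.
rewrite -[giter_diff p.+2 F U _]/(god_unit (giter p.+2 F) U (giter_diff p.+1 F U s)
  - god_map (giter_diff p.+1 F) U (giter_diff p.+1 F U s)).
rewrite -god_map_unit -(raddfB (god_map _ U)).
rewrite -[giter_diff p.+1 F U s]/(god_unit (giter p.+1 F) U s
  - god_map (giter_diff p F) U s).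
by rewrite opprB addrCA subrr addr0 (god_map_comp0 IH).
Qed.

(** The value of [c] at [x] lies in the stalk of the previous iterate and is the germ of some [b].
    The cocycle condition, read at [x], says that [c] and d_p b have the same germ there. *)
Lemma giter_diff_exact p (F : sheaf X) :
  locally_exact (giter_diff p F) (giter_diff p.+1 F).
Proof.
move=> U c /= + x Ux; rewrite /hom_sub_app => /eqP; rewrite subr_eq0 => /eqP.
move=> /(congr1 (fun s : god_sections _ U => s x Ux)).
rewrite -[LHS]/(stalk_germ Ux c) /= /god_map_app.
have [W [Wx [b ->]]] := stalk_germ_surj ((c : god_sections _ U) x Ux).
rewrite stalk_map_germ => /stalk_germ_inj[N [hU [hW [Nx cb]]]].
by exists N, hU; split=> //; exists (res (giter p F) hW b); rewrite hom_nat cb.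
Qed.

Lemma giter_map_local p (F G : sheaf X) (f g : sheaf_hom F G) (U : opens X) :
  agree_on U f g -> agree_on U (giter_map p f) (giter_map p g).
Proof. by elim: p => //= p IH /IH; exact: god_map_local. Qed.

Lemma giter_map_id p (F : sheaf X) (U : opens X) (s : giter p F U) :
  giter_map p hom_id U s = s.
Proof.
elim: p U s => //= p IH U s; rewrite -[RHS]god_map_id.
by apply: (@god_map_local _ _ _ _ U) => // V _ t; exact: IH.
Qed.

Lemma giter_map_zero p (F G : sheaf X) (U : opens X) (s : giter p F U) :
  giter_map p (hom_zero : sheaf_hom F G) U s = 0.
Proof.
elim: p U s => //= p IH U s; rewrite -[RHS](god_map_zero _ s).
by apply: (@god_map_local _ _ _ _ U) => // V _ t; exact: IH.
Qed.

Lemma giter_map_comp0 p (F G H : sheaf X) (f : sheaf_hom F G) (g : sheaf_hom G H) :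
  (forall U s, g U (f U s) = 0) ->
  forall U s, giter_map p g U (giter_map p f U s) = 0.
Proof. by move=> gf; elim: p => //= p; exact: god_map_comp0. Qed.

Lemma giter_map_eq0 p (F G : sheaf X) (f : sheaf_hom F G) :
  (forall U s, f U s = 0 -> s = 0) ->
  forall U s, giter_map p f U s = 0 -> s = 0.
Proof. by move=> f0; elim: p => //= p; exact: god_map_eq0. Qed.

Lemma giter_map_exact p (F G H : sheaf X) (f : sheaf_hom F G) (g : sheaf_hom G H) :
  locally_exact f g -> locally_exact (giter_map p f) (giter_map p g).
Proof.
move=> ex; elim: p => //= p /god_exact fg U t /fg[s <-] x Ux.
by exists U, (fun y h => h); split=> //; exists s; rewrite res_id.
Qed.

Lemma giter_fine_exact (F : sheaf X) (U : opens X) p (c : giter p.+1 F U) :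
  paracompact X -> paracompact_on U -> fine F ->
  giter_diff p.+1 F U c = 0 -> exists b, giter_diff p F U b = c.
Proof.
move=> pX pU fF c0.
apply: (@fine_lift X F (giter p F) (giter p.+1 F) (giter_diff p F)
  (fun psi => giter_map p psi) (fun psi => giter_map p.+1 psi)) => //.
- by move=> psi V s; rewrite giter_diff_nat.
- by move=> V phi psi; exact: giter_map_local.
- by move=> V phi psi; exact: giter_map_local.
- by move=> V s; exact: giter_map_zero.
- by move=> V s; exact: giter_map_zero.
- by move=> V s; exact: giter_map_id.
exact: giter_diff_exact.
Qed.

Definition giter_complex (F : sheaf X) : sheaf_complex X :=
  @SheafComplex X (fun p => giter p F) (fun p => giter_diff p F)
    (fun p U s => @giter_diffK p F U s).

Lemma giter_flabby_exact (F : sheaf X) (U : opens X) p (c : giter p.+1 F U) :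
  flabby F -> giter_diff p.+1 F U c = 0 -> exists b, giter_diff p F U b = c.
Proof.
move=> fF c0; apply: (@flabby_complex_exact X (giter_complex F) U) => //.
- by move=> q; exact: giter_flabby.
- move=> V h s /god_unit_eq0 ->; exists 0; split; exact: raddf0.
by move=> q V d _; exact: giter_diff_exact.
Qed.

Lemma giter_diff0_eq0 (F : sheaf X) (U : opens X) (s : F U) :
  giter_diff 0 F U s = 0 -> s = 0.
Proof. exact: god_unit_eq0. Qed.

End Godement.

(** * Cech complexes *)

Section CechSheaf.
Context {X : topologicalType} {J : Type} (W : J -> opens X).

Lemma oI_mono (U U' V V' : opens X) : U `<=` U' -> V `<=` V' -> oI U V `<=` oI U' V'.
Proof. by move=> hU hV x [/hU Ux /hV Vx]. Qed.

Section Sheaf.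
Context (F : presheaf X).

(* Cochains with values in slice V are the sections over V of the sheaf of Cech
   cochains. *)
Section Slice.
Context (V : opens X).

Definition slice_res (U U' : opens X) (h : U' `<=` U) :
    {additive F (oI V U) -> F (oI V U')} :=
  res F (oI_mono (fun x (Vx : V x) => Vx) h).

Fact slice_res_id (U : opens X) (h : U `<=` U) s : slice_res h s = s.
Proof. exact: res_id. Qed.

Fact slice_res_comp (U U' U'' : opens X) (h : U' `<=` U) (h' : U'' `<=` U')
  (h'' : U'' `<=` U) s : slice_res h' (slice_res h s) = slice_res h'' s.
Proof. exact: res_comp. Qed.

Definition slice : presheaf X :=
  @Presheaf X (fun U => F (oI V U)) slice_res slice_res_id slice_res_comp.

End Slice.

Context (p : nat).

Definition cech_sections (V : opens X) : zmodType := cochain W (slice V) p.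

Definition cech_res (V V' : opens X) (h : V' `<=` V) (s : cech_sections V) :
    cech_sections V' :=
  fun a => res F (oI_mono h (fun x (ax : cap W a x) => ax)) (s a).

Fact cech_res_additive (V V' : opens X) (h : V' `<=` V) : zmod_morphism (cech_res h).
Proof.
move=> s t; apply: dprodP => a; rewrite /cech_res !dprodBE; exact: raddfB.
Qed.

HB.instance Definition _ (V V' : opens X) (h : V' `<=` V) :=
  GRing.isZmodMorphism.Build (cech_sections V) (cech_sections V') (cech_res h)
    (cech_res_additive h).

Fact cech_res_id (V : opens X) (h : V `<=` V) s : cech_res h s = s.
Proof. by apply: dprodP => a; rewrite /cech_res res_id. Qed.

Fact cech_res_comp (V V' V'' : opens X) (h : V' `<=` V) (h' : V'' `<=` V')
  (h'' : V'' `<=` V) s : cech_res h' (cech_res h s) = cech_res h'' s.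
Proof. by apply: dprodP => a; apply: (@res_comp X F). Qed.

Definition cech_presheaf : presheaf X :=
  @Presheaf X cech_sections (fun U V h => @cech_res U V h) cech_res_id cech_res_comp.

Lemma slice_cochain_eq (V N : opens X) (s : cech_sections V) (a b : 'I_p.+1 -> J)
    (ha : N `<=` oI V (cap W a)) (hb : N `<=` oI V (cap W b)) :
  a = b -> res F ha (s a) = res F hb (s b).
Proof. by move=> ab; subst b; exact: res_irr. Qed.

End Sheaf.

Fact cech_is_sheaf (F : sheaf X) p : is_sheaf (cech_presheaf F p).
Proof.
move=> U I V hV cU s sc.
have hVa (a : 'I_p.+1 -> J) i : oI (V i) (cap W a) `<=` oI U (cap W a).
  by apply: oI_mono; [exact: hV|].
have cUa (a : 'I_p.+1 -> J) : oI U (cap W a) `<=` \bigcup_i (oI (V i) (cap W a)).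
  by move=> x [/cU[i _ Vx] ax]; exists i.
have glue a : exists! t : F (oI U (cap W a)),
    forall i, res F (hVa a i) t = (s i : cech_sections F p (V i)) a.
  apply: sheafP => // i j.
  have := congr1 (fun f : cech_sections F p (oI (V i) (V j)) => f a) (sc i j).
  rewrite /= /cech_res => E.
  have h : oI (oI (V i) (cap W a)) (oI (V j) (cap W a)) `<=` oI (oI (V i) (V j)) (cap W a).
    by move=> x [[Vi ax] [Vj _]].
  rewrite -(res_comp (oI_mono (@oIl _ (V i) (V j)) (fun x (ax : cap W a x) => ax)) h).
  rewrite E.
  by rewrite (res_comp _ _ (@oIr _ (oI (V i) (cap W a)) (oI (V j) (cap W a)))).
exists (fun a => sval (cid (glue a))); split=> [i|t tE]; apply: dprodP => a.
  rewrite /= /cech_res; case: cid => t [/= tE _]; rewrite -tE; exact: res_irr.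
case: cid => u [/= _ uu]; apply: uu => i; rewrite -tE /= /cech_res; exact: res_irr.
Qed.

Definition cech_sheaf (F : sheaf X) p : sheaf X := Sheaf (@cech_is_sheaf F p).

Fact cech_sheaf_diff_nat (F : sheaf X) p (U V : opens X) (h : V `<=` U)
    (s : cech_sheaf F p U) :
  cech_diff (res (cech_sheaf F p) h s) = res (cech_sheaf F p.+1) h (cech_diff s).
Proof.
apply: dprodP => a; rewrite /= /cech_res /cech_diff raddf_sum.
apply: eq_bigr => v _; rewrite raddfMz /=; congr (_ *~ _).
rewrite /slice_res; set N := oI V (cap W a).
have hN : N `<=` oI U (cap W (face a v)).
  by apply: oI_mono => //; exact: cap_face.
by rewrite !(res_comp _ _ hN).
Qed.

Definition cech_sheaf_diff (F : sheaf X) p : sheaf_hom (cech_sheaf F p) (cech_sheaf F p.+1) :=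
  @Defs.Hom X (cech_sheaf F p) (cech_sheaf F p.+1)
    (fun U => @cech_diff X J W (slice F U) p) (@cech_sheaf_diff_nat F p).

Definition cech_sheaf_complex (F : sheaf X) : sheaf_complex X :=
  @SheafComplex X (cech_sheaf F) (cech_sheaf_diff F)
    (fun p U s => @cech_diffK X J W (slice F U) p s).

Section Map.
Context {F G : sheaf X} (f : sheaf_hom F G) (p : nat).

Definition cech_sheaf_map_app (V : opens X) (s : cech_sheaf F p V) : cech_sheaf G p V :=
  fun a => f (oI V (cap W a)) (s a).

Fact cech_sheaf_map_additive V : zmod_morphism (@cech_sheaf_map_app V).
Proof.
move=> s t; apply: dprodP => a; rewrite /cech_sheaf_map_app !dprodBE; exact: raddfB.
Qed.

HB.instance Definition _ V :=
  GRing.isZmodMorphism.Build (cech_sheaf F p V) (cech_sheaf G p V)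
    (@cech_sheaf_map_app V) (@cech_sheaf_map_additive V).

Fact cech_sheaf_map_nat (U V : opens X) (h : V `<=` U) (s : cech_sheaf F p U) :
  cech_sheaf_map_app (res (cech_sheaf F p) h s)
  = res (cech_sheaf G p) h (cech_sheaf_map_app s).
Proof. by apply: dprodP => a; rewrite /= /cech_sheaf_map_app /cech_res hom_nat. Qed.

Definition cech_sheaf_map : sheaf_hom (cech_sheaf F p) (cech_sheaf G p) :=
  @Defs.Hom X (cech_sheaf F p) (cech_sheaf G p) (fun V => @cech_sheaf_map_app V)
    cech_sheaf_map_nat.

End Map.

Lemma cech_sheaf_map_diff (F G : sheaf X) (f : sheaf_hom F G) p U s :
  cech_sheaf_diff G p U (cech_sheaf_map f p U s)
  = cech_sheaf_map f p.+1 U (cech_sheaf_diff F p U s).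
Proof.
apply: dprodP => a; rewrite /= /cech_diff /cech_sheaf_map_app raddf_sum.
by apply: eq_bigr => v _; rewrite raddfMz /= /slice_res hom_nat.
Qed.

Definition cons_index p (i : J) (a : 'I_p.+1 -> J) : 'I_p.+2 -> J :=
  fun j => if unlift ord0 j is Some k then a k else i.

Lemma face_cons0 p i (a : 'I_p.+1 -> J) : face (cons_index i a) ord0 = a.
Proof. by apply/funext => j; rewrite /face /cons_index liftK. Qed.

Lemma face_consS p i (a : 'I_p.+2 -> J) v :
  face (cons_index i a) (lift ord0 v) = cons_index i (face a v).
Proof.
apply/funext => j; rewrite /face /cons_index.
case: (unliftP ord0 j) => [k|] ->.
  have -> : lift (lift ord0 v) (lift ord0 k) = lift ord0 (lift v k).
    by apply: val_inj; rewrite /= /bump /=; lia.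
  by rewrite liftK.
have -> : lift (lift ord0 v) ord0 = ord0 :> 'I_p.+3 by exact: val_inj.
by rewrite unlift_none.
Qed.

Lemma cap_cons p i (a : 'I_p.+1 -> J) (V : opens X) : V `<=` W i ->
  oI V (cap W a) `<=` oI V (cap W (cons_index i a)).
Proof.
move=> Vi x [Vx ax]; split=> // j _; rewrite /cons_index.
by case: unlift => [k|]; [exact: ax|exact: Vi].
Qed.

(* The contracting homotopy (h c)_a = c_(i, a) over an open subset of W_i. *)
Lemma cech_sheaf_contract (F : sheaf X) p (V : opens X) i (c : cech_sheaf F p.+1 V) :
  V `<=` W i -> cech_sheaf_diff F p.+1 V c = 0 ->
  exists b, cech_sheaf_diff F p V b = c.
Proof.
move=> Vi c0.
exists (fun a => res F (cap_cons (a := a) Vi) ((c : cech_sections F p.+1 V) (cons_index i a))).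
apply: dprodP => a; rewrite /= /cech_diff; set N := oI V (cap W a).
have hN : N `<=` oI V (cap W (cons_index i a)) by exact: cap_cons.
(* The cocycle condition is read at (i, a): face 0 yields c_a, and the other faces yield minus the
   coboundary of the homotopy at [a]. *)
have := congr1 (fun s : cech_sections F p.+2 V => res F hN (s (cons_index i a))) c0.
rewrite /= /cech_diff raddf0 big_ord_recl raddfD raddf_sum /= expr0 mulr1z.
move=> /eqP; rewrite addr_eq0 => /eqP E.
transitivity (res F (fun x (Nx : N x) => Nx) ((c : cech_sections F p.+1 V) a)); last exact: res_id.
have h0 : N `<=` oI V (cap W (face (cons_index i a) ord0)) by rewrite face_cons0.
rewrite (slice_cochain_eq c _ h0 (esym (face_cons0 i a))).
move: E; rewrite /slice_res (res_comp _ _ h0) => ->.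
rewrite -sumrN; apply: eq_bigr => v _.
rewrite raddfMz /= exprS mulN1r mulrNz opprK; congr (_ *~ _).
have hv : N `<=` oI V (cap W (face (cons_index i a) (lift ord0 v))).
  by apply: subset_trans hN _; apply: oI_mono => //; exact: cap_face.
have hv' : N `<=` oI V (cap W (cons_index i (face a v))) by rewrite -face_consS.
rewrite (res_comp _ _ hv) (res_comp _ _ hv').
by rewrite (slice_cochain_eq c hv hv' (face_consS i a v)).
Qed.

Section Covering.
Context (Omega : opens X) (cover_Omega : Omega `<=` \bigcup_i W i).

Lemma cech_sheaf_locally_exact (F : sheaf X) p (U : opens X) (c : cech_sheaf F p.+1 U) :
  U `<=` Omega -> cech_sheaf_diff F p.+1 U c = 0 ->
  locally_lifts (cech_sheaf_diff F p) c.
Proof.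
move=> UO c0 x Ux; have [i _ Wx] := cover_Omega (UO x Ux).
pose h := @oIl _ U (W i).
exists (oI U (W i)), h; split=> //.
apply: (@cech_sheaf_contract F p _ i); first exact: oIr.
by rewrite hom_nat c0 raddf0.
Qed.

Lemma cech_sheaf_glue (F : sheaf X) (U : opens X) (s : cech_sheaf F 0 U) :
  U `<=` Omega -> cech_sheaf_diff F 0 U s = 0 ->
  exists t : F U, forall a : 'I_1 -> J,
    (s : cech_sections F 0 U) a = res F (@oIl _ U (cap W a)) t.
Proof.
move=> UO s0.
have cU : U `<=` \bigcup_a (oI U (cap W (a : 'I_1 -> J))).
  move=> x Ux; have [i _ Wx] := cover_Omega (UO x Ux).
  by exists (fun=> i) => //; split=> // j _.
have [a b|t [tE _]] := @sheafP X F U _ (fun a : 'I_1 -> J => oI U (cap W a))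
    (fun a => @oIl _ U (cap W a)) cU (fun a => (s : cech_sections F 0 U) a).
  (* Agreement on the overlap of W_a and W_b is the cocycle condition at the pair (a, b), whose
     faces are [b] and [a]. *)
  set N := oI _ _; pose ab := cons_index (a ord0) b.
  have hN : N `<=` oI U (cap W ab).
    move=> x [[Ux ax] [_ bx]]; split=> // j _; rewrite /ab /cons_index.
    by case: unlift => [k|]; [exact: bx|exact: ax].
  have fb : face ab ord0 = b by exact: face_cons0.
  have fa : face ab (lift ord0 ord0) = a.
    apply/funext => j; rewrite /face /ab /cons_index (ord1 j).
    have -> : lift (lift ord0 ord0) ord0 = ord0 :> 'I_2 by exact: val_inj.
    by rewrite unlift_none.
  have := congr1 (fun s : cech_sections F 1 U => res F hN (s ab)) s0.
  rewrite /= /cech_diff raddf0 big_ord_recl big_ord1 raddfD /= expr0 expr1.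
  rewrite mulrNz !mulr1z raddfN => /eqP; rewrite subr_eq0 => /eqP.
  have hb : N `<=` oI U (cap W (face ab ord0)) by rewrite fb; exact: oIr.
  have ha : N `<=` oI U (cap W (face ab (lift ord0 ord0))) by rewrite fa; exact: oIl.
  rewrite /slice_res (res_comp _ _ hb) (res_comp _ _ ha) => E.
  by rewrite -(slice_cochain_eq s hb _ fb) -(slice_cochain_eq s ha _ fa).
by exists t => a; rewrite tE.
Qed.

Lemma cech_sheaf_flabby (F : sheaf X) p : flabby F -> flabby (cech_sheaf F p).
Proof.
move=> fF U s.
have ext a : exists t : F (oI oT (cap W a)),
    res F (oI_mono (@sub_oT _ U) (fun x (ax : cap W a x) => ax)) t
    = (s : cech_sections F p U) a.
  have [t tE] := fF _ ((s : cech_sections F p U) a).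
  exists (res F (@sub_oT _ _) t); rewrite -tE; exact: res_comp.
by exists (fun a => sval (cid (ext a))); apply: dprodP => a /=; rewrite /cech_res; case: cid.
Qed.

(** By gluing, the kernel in degree 0 consists of restrictions of sections of [F], so it inherits
    flabbiness from [F]. *)
Lemma cech_sheaf_flabby_exact (F : sheaf X) p (c : cech_sheaf F p.+1 Omega) :
  flabby F -> cech_sheaf_diff F p.+1 Omega c = 0 ->
  exists b, cech_sheaf_diff F p Omega b = c.
Proof.
move=> fF c0; apply: (@flabby_complex_exact X (cech_sheaf_complex F) Omega) => //.
- by move=> q; exact: cech_sheaf_flabby.
- move=> V h s s0; have [t tE] := cech_sheaf_glue h s0.
  have [t' t'E] := fF V t.
  pose u : cech_sections F 0 Omega := fun a => res F (@sub_oT _ _) t'.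
  exists u; split.
    apply: dprodP => a; rewrite /= /cech_diff big_ord_recl big_ord1 /= expr0 expr1.
    by rewrite mulrNz !mulr1z /slice_res /u !(res_comp _ _ (@sub_oT _ _)) subrr.
  apply: dprodP => a; rewrite tE -t'E /= /cech_res /u.
  by rewrite !(res_comp _ _ (@sub_oT _ _)).
- by move=> q U d; exact: cech_sheaf_locally_exact.
Qed.

Lemma cech_sheaf_fine_exact (F : sheaf X) p (c : cech_sheaf F p.+1 Omega) :
  paracompact X -> paracompact_on Omega -> fine F ->
  cech_sheaf_diff F p.+1 Omega c = 0 -> exists b, cech_sheaf_diff F p Omega b = c.
Proof.
move=> pX pO fF c0.
apply: (@fine_lift X F (cech_sheaf F p) (cech_sheaf F p.+1) (cech_sheaf_diff F p)
  (fun psi => cech_sheaf_map psi p) (fun psi => cech_sheaf_map psi p.+1)) => //.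
- by move=> psi V s; exact: cech_sheaf_map_diff.
- move=> V phi psi e V' V'V s; apply: dprodP => a; apply: e.
  by move=> x [/V'V].
- move=> V phi psi e V' V'V s; apply: dprodP => a; apply: e.
  by move=> x [/V'V].
exact: cech_sheaf_locally_exact.
Qed.

Hypothesis W_sub : forall j, W j `<=` Omega.

Lemma cap_sub p (a : 'I_p.+1 -> J) : cap W a `<=` Omega.
Proof. by move=> x /(_ ord0 Logic.I)/W_sub. Qed.

Lemma cap_slice p (a : 'I_p.+1 -> J) : cap W a `<=` oI Omega (cap W a).
Proof. by move=> x ax; split=> //; exact: (cap_sub ax). Qed.

(** The sets [oI Omega (cap W a)] and [cap W a] have the same points but are different terms, so
    restriction maps carry cochains back and forth. *)
Lemma cech_exact_of_slice (F : sheaf X) p (c : cochain W F p.+1) :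
  (forall c' : cech_sheaf F p.+1 Omega, cech_sheaf_diff F p.+1 Omega c' = 0 ->
     exists b, cech_sheaf_diff F p Omega b = c') ->
  cech_diff c = 0 -> exists b : cochain W F p, cech_diff b = c.
Proof.
move=> ex c0.
pose c' : cech_sections F p.+1 Omega := fun a => res F (@oIr _ Omega (cap W a)) (c a).
have [|b bE] := ex c'.
  apply: dprodP => a; rewrite /= /cech_diff.
  transitivity (res F (@oIr _ Omega (cap W a)) (cech_diff c a)); last first.
    by rewrite c0 raddf0.
  rewrite /cech_diff raddf_sum; apply: eq_bigr => v _; rewrite raddfMz /=.
  have h : oI Omega (cap W a) `<=` cap W (face a v).
    by apply: subset_trans (@oIr _ _ _) _; exact: cap_face.
  by rewrite /slice_res /c' !(res_comp _ _ h).
exists (fun a => res F (cap_slice (a := a)) ((b : cech_sections F p Omega) a)).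
apply: dprodP => a; transitivity (res F (cap_slice (a := a)) (c' a)); last first.
  by rewrite /c' (res_comp _ _ (fun x h => h)) res_id.
rewrite -bE /= /cech_diff raddf_sum; apply: eq_bigr => v _; rewrite raddfMz /=.
congr (_ *~ _).
have h : cap W a `<=` oI Omega (cap W (face a v)).
  by apply: subset_trans (cap_slice (a := a)) _; apply: oI_mono => //; exact: cap_face.
by rewrite /slice_res !(res_comp _ _ h).
Qed.

Theorem cech_flabby_exact (F : sheaf X) p (c : cochain W F p.+1) :
  flabby F -> cech_diff c = 0 -> exists b : cochain W F p, cech_diff b = c.
Proof.
by move=> fF; apply: cech_exact_of_slice => c'; exact: cech_sheaf_flabby_exact.
Qed.

Theorem cech_fine_exact (F : sheaf X) p (c : cochain W F p.+1) :
  paracompact X -> paracompact_on Omega -> fine F ->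
  cech_diff c = 0 -> exists b : cochain W F p, cech_diff b = c.
Proof.
by move=> pX pO fF; apply: cech_exact_of_slice => c'; exact: cech_sheaf_fine_exact.
Qed.

Lemma cech_glue (F : sheaf X) (s : cochain W F 0) : cech_diff s = 0 ->
  exists t : F Omega, forall (a : 'I_1 -> J) (h : cap W a `<=` Omega), s a = res F h t.
Proof.
move=> s0.
pose s' : cech_sections F 0 Omega := fun a => res F (@oIr _ Omega (cap W a)) (s a).
have [//||t tE] := @cech_sheaf_glue F Omega s'.
  apply: dprodP => a; rewrite /= /cech_diff.
  transitivity (res F (@oIr _ Omega (cap W a)) (cech_diff s a)); last first.
    by rewrite s0 raddf0.
  rewrite /cech_diff raddf_sum; apply: eq_bigr => v _; rewrite raddfMz /=.
  have h : oI Omega (cap W a) `<=` cap W (face a v).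
    by apply: subset_trans (@oIr _ _ _) _; exact: cap_face.
  by rewrite /slice_res /s' !(res_comp _ _ h).
exists t => a h; rewrite -(res_comp (@oIl _ Omega (cap W a)) (cap_slice (a := a))).
by rewrite -tE /s' (res_comp _ _ (fun x h => h)) res_id.
Qed.

End Covering.
End CechSheaf.

(** * Comparison *)

Section RelativeCech.
Context {X : topologicalType} {I : Type} (W : I -> opens X) (I' : set I).

Definition subfamily (j : {i | I' i}) : opens X := W (sval j).

Lemma cap_subfamily p (a : 'I_p.+1 -> {i | I' i}) :
  cap subfamily a `<=` cap W (fun j => sval (a j)).
Proof. by []. Qed.

Lemma subfamily_cap p (a : 'I_p.+1 -> I) (h : forall j, I' (a j)) :
  cap W a `<=` cap subfamily (fun j => exist I' (a j) (h j)).
Proof. by []. Qed.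

Section Cochains.
Context (F : presheaf X).

Definition sub_cochain p (s : cochain W F p) : cochain subfamily F p :=
  fun a => res F (@cap_subfamily p a) (s (fun j => sval (a j))).

Lemma sub_cochainB p (s t : cochain W F p) :
  sub_cochain (s - t) = sub_cochain s - sub_cochain t.
Proof.
by apply: dprodP => a; rewrite dprodBE /sub_cochain dprodBE (raddfB (res F _)).
Qed.

Lemma sub_cochain_diff p (s : cochain W F p) :
  sub_cochain (cech_diff s) = cech_diff (sub_cochain s).
Proof.
apply: dprodP => a; rewrite /sub_cochain /cech_diff raddf_sum.
apply: eq_bigr => v _; rewrite raddfMz /=; congr (_ *~ _).
have h : cap subfamily a `<=` cap W (face (fun j => sval (a j)) v).
  by apply: subset_trans (@cap_subfamily p.+1 a) _; exact: cap_face.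
by rewrite !(res_comp _ _ h).
Qed.

Lemma rel_cochainsP p (s : cochain W F p) :
  reflect (sub_cochain s = 0) (s \in rel_cochains W F I' p).
Proof.
apply: (iffP (asboolP _)) => [s0|s0 a h].
  apply: dprodP => a; rewrite /sub_cochain s0 ?raddf0 // => j.
  exact: (proj2_sig (a j)).
have := congr1 (fun t : cochain subfamily F p =>
  res F (subfamily_cap h) (t (fun j => exist I' (a j) (h j)))) s0.
rewrite /= /sub_cochain raddf0 (res_comp _ _ (fun x h => h)) => <-.
by rewrite res_id.
Qed.

(** Extension by zero splits the sequence 0 -> C(W, W') -> C(W) -> C(W') -> 0 degree by degree; it
    does not commute with the Cech differential in general. *)
Definition extend_cochain p (e : cochain subfamily F p) : cochain W F p := fun a =>
  if pselect (forall j, I' (a j)) is left h then res F (subfamily_cap h) (e _) else 0.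

Lemma extend_cochainK p (e : cochain subfamily F p) :
  sub_cochain (extend_cochain e) = e.
Proof.
apply: dprodP => a; rewrite /sub_cochain /extend_cochain.
case: pselect => [h|]; last by case=> j; exact: (proj2_sig (a j)).
pose a' j := exist I' (sval (a j)) (h j).
have h1 : cap subfamily a `<=` cap subfamily a' by [].
rewrite (res_comp _ _ h1).
have aE : a' = a.
  apply/funext => j; rewrite /a'; case: (a j) (h j) => i Ii h'.
  by congr exist; exact: Prop_irrelevance.
by rewrite (cochain_res_eq e h1 (fun x h => h) aE) res_id.
Qed.

Definition const_cochain (t : F oT) : cochain W F 0 := fun a => res F (@sub_oT _ _) t.

Lemma const_cochain_diff t : cech_diff (const_cochain t) = 0.
Proof.
apply: dprodP => a; rewrite /cech_diff big_ord_recl big_ord1 /= expr0 expr1.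
by rewrite mulrNz !mulr1z /const_cochain !(res_comp _ _ (@sub_oT _ _)) subrr.
Qed.

End Cochains.

Context (X' : opens X).
Hypothesis cover_X : oT `<=` \bigcup_i W i.
Hypothesis cover_X' : cover I' (fun i => W i) = X'.

Lemma subfamily_sub j : subfamily j `<=` X'.
Proof. by move=> x Wx; rewrite -cover_X'; exists (sval j); [exact: (proj2_sig j)|]. Qed.

Lemma subfamily_cover : X' `<=` \bigcup_j subfamily j.
Proof. by move=> x; rewrite -{1}cover_X' => -[i I'i Wx]; exists (exist I' i I'i). Qed.

(** An absolute primitive [b] restricts to a cocycle of the subfamily. In positive degree that
    cocycle is the coboundary of some [e], and the coboundary of an extension of [e] is subtracted
    from [b]. In degree 0 it is a section over X', which flabbiness extends to [X] before it is
    subtracted. *)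
Theorem rel_cech_flabby_exact (F : sheaf X) p (c : cochain W F p.+1) : flabby F ->
  c \in rel_cochains W F I' p.+1 -> cech_diff c = 0 ->
  exists2 b : cochain W F p, b \in rel_cochains W F I' p & cech_diff b = c.
Proof.
move=> fF /rel_cochainsP c0 dc.
have [b bE] := cech_flabby_exact cover_X (fun i => @sub_oT _ (W i)) fF dc.
have b0 : cech_diff (sub_cochain b) = 0 by rewrite -sub_cochain_diff bE.
case: p => [|p] in c c0 dc b bE b0 *.
  have [t tE] := cech_glue subfamily_cover subfamily_sub b0.
  have [t' t'E] := fF _ t.
  exists (b - const_cochain t').
    apply/rel_cochainsP; rewrite sub_cochainB; apply/eqP; rewrite subr_eq0; apply/eqP.
    apply: dprodP => a.
    rewrite (tE a (cap_sub subfamily_sub (a := a))) -t'E.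
    by rewrite /sub_cochain /const_cochain !(res_comp _ _ (@sub_oT _ _)).
  by rewrite (raddfB (@cech_diff X I W F 0)) /= bE const_cochain_diff subr0.
have [e eE] := cech_flabby_exact subfamily_cover subfamily_sub fF b0.
exists (b - cech_diff (extend_cochain e)).
  apply/rel_cochainsP.
  by rewrite sub_cochainB sub_cochain_diff extend_cochainK eE subrr.
by rewrite (raddfB (@cech_diff X I W F p.+1)) /= cech_diffK bE subr0.
Qed.

Section VanishingSections.
Context (L : sheaf_complex X).

Fact const_cochain_rel q (s : vanishing_section_complex L X' q) :
  const_cochain (val s : L q oT) \in rel_cochains W (L q) I' 0.
Proof.
apply/asboolP => a h; have s0 : res (L q) (@sub_oT _ X') (val s) = 0.
  by apply/eqP; exact: (valP s).
have aX' : cap W a `<=` X'.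
  by move=> x /(_ ord0 Logic.I) Wx; rewrite -cover_X'; exists (a ord0).
by rewrite /const_cochain -(res_comp (@sub_oT _ X') aX') s0 raddf0.
Qed.

Definition vanishing_restrict q (s : vanishing_section_complex L X' q) :
    cech_bicomplex W L I' 0%N q :=
  exist (fun t => t \in rel_cochains W (L q) I' 0) _ (const_cochain_rel s).

Fact vanishing_restrict_additive q : zmod_morphism (@vanishing_restrict q).
Proof.
by move=> s t; apply: val_inj; apply: dprodP => a; exact: (raddfB (res (L q) _)).
Qed.

HB.instance Definition _ q :=
  GRing.isZmodMorphism.Build (vanishing_section_complex L X' q)
    (cech_bicomplex W L I' 0%N q) (@vanishing_restrict q)
    (@vanishing_restrict_additive q).

Fact vanishing_restrict_del q (s : vanishing_section_complex L X' q) :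
  bdel (cech_bicomplex W L I') 0%N q (vanishing_restrict s) = 0.
Proof. by apply: val_inj; exact: const_cochain_diff. Qed.

Fact vanishing_restrict_dif q (s : vanishing_section_complex L X' q) :
  bdif (cech_bicomplex W L I') 0%N q (vanishing_restrict s)
  = vanishing_restrict (diff (vanishing_section_complex L X') q s).
Proof. by apply: val_inj; apply: dprodP => a; exact: hom_nat. Qed.

Definition vanishing_to_cech :
    cmap (vanishing_section_complex L X') (cech_total W L I') :=
  @edge_p0_cmap (vanishing_section_complex L X') (cech_bicomplex W L I')
    (fun q => @vanishing_restrict q) vanishing_restrict_del vanishing_restrict_dif.

Theorem vanishing_to_cech_bij q : (forall r, flabby (L r)) ->
  bijective (coh_map vanishing_to_cech q).
Proof.
move=> fL; apply: edge_p0_bij => [p r [c cR] /(congr1 val) /= dc|r s|r [y yR]].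
- have [b bR bE] := rel_cech_flabby_exact (fL r) cR dc.
  exists (exist (fun t => t \in rel_cochains W (L r) I' p) b bR).
  exact: val_inj.
- move=> /(congr1 val) /= s0; apply: val_inj.
  apply: (@sheaf_sep X (L r) oT I W (fun i => @sub_oT _ _)) => // i.
  rewrite [val 0]/= raddf0.
  have h : W i `<=` cap W (fun _ : 'I_1 => i) by move=> x Wx j _.
  rewrite -(res_comp (@sub_oT _ (cap W (fun _ : 'I_1 => i))) h).
  rewrite -[res (L r) _ (val s)]/(const_cochain (val s) (fun=> i)) s0.
  exact: raddf0.
move=> /(congr1 val) /= dy.
have [t tE] := cech_glue cover_X (fun i => @sub_oT _ (W i)) dy.
(* The glued section vanishes on each member of the subfamily, where the relative cochain is zero,
   and these members cover X'. *)
have tX' : t \in ker (res (L r) (@sub_oT _ X')).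
  rewrite kerE; apply/eqP.
  apply: (@sheaf_sep X (L r) X' _ subfamily subfamily_sub); first exact: subfamily_cover.
  move=> j; rewrite raddf0 (res_comp _ _ (@sub_oT _ _)).
  have h : subfamily j `<=` cap W (fun _ : 'I_1 => sval j) by move=> x Wx k _.
  rewrite -(res_comp (@sub_oT _ (cap W (fun _ : 'I_1 => sval j))) h) -tE.
  have /asboolP -> := yR; first exact: raddf0.
  by move=> _; exact: (proj2_sig j).
exists (exist (fun s => s \in ker (res (L r) (@sub_oT _ X'))) t tX').
by apply: val_inj; apply: dprodP => a /=; rewrite (tE a (@sub_oT _ _)).
Qed.

End VanishingSections.
End RelativeCech.

(** * Columns of the Cech double complex *)

Section CechColumns.
Context {X : topologicalType} {I : Type} (W : I -> opens X) (I' : set I).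
Context (M : sheaf_complex X).

Lemma cech_columns_exact p r (x : cech_bicomplex W M I' p r.+1) : good W M ->
  bdif (cech_bicomplex W M I') p r.+1 x = 0 ->
  exists y, bdif (cech_bicomplex W M I') p r y = x.
Proof.
move=> gM; case: x => x xR /(congr1 val) dx.
have ex a : exists y : M r (cap W a), sdiff M r _ y = x a.
  apply: (@exact_of_cohomology0 (section_complex M (cap W a))); first exact: gM.
  exact: (congr1 (fun s : cochain W (M r.+2) p => s a) dx).
(* On tuples of I' the cochain [x] is zero, and the primitive 0 is chosen there to keep [y]
   relative. *)
pose y : cochain W (M r) p := fun a =>
  if pselect (forall j, I' (a j)) then 0 else sval (cid (ex a)).
have yR : y \in rel_cochains W (M r) I' p.
  by apply/asboolP => a h; rewrite /y; case: pselect.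
exists (exist (fun t => t \in rel_cochains W (M r) I' p) y yR).
apply: val_inj; apply: dprodP => a; rewrite /= /cochain_map /y.
case: pselect => h; last by case: cid.
by rewrite raddf0; have /asboolP/(_ a h) := xR.
Qed.

Context (S : sheaf X) (e : sheaf_hom S (M 0%N)).

Definition left_exact :=
  forall (U : opens X) (t : M 0%N U), sdiff M 0 U t = 0 -> exists s, e U s = t.

Lemma resolution_eq0 U s : injective_hom e -> e U s = 0 -> s = 0.
Proof. by move=> ie e0; apply: (ie U); rewrite e0 raddf0. Qed.

(** Local lifts are unique by injectivity of [e], hence they glue. *)
Lemma resolution_left_exact : injective_hom e -> exact_at e (sdiff M 0) -> left_exact.
Proof.
move=> ie ee U t t0; have loc := (ee U t).1 t0.
have loc' (x : {x | U x}) : exists V : opens X, V (sval x) /\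
    exists (h : V `<=` U) (s : S V), e V s = res (M 0%N) h t.
  by case: x => x Ux; have [V [h [Vx [s sE]]]] := loc x Ux; exists V; split=> //; exists h, s.
pose V x := sval (cid (loc' x)).
have VP x : exists (h : V x `<=` U) (s : S (V x)), e (V x) s = res (M 0%N) h t.
  by rewrite /V; case: cid => ? [].
have hV x : V x `<=` U by case: (VP x).
have lift x : exists s : S (V x), e (V x) s = res (M 0%N) (hV x) t.
  by have [h [s sE]] := VP x; exists s; rewrite sE; exact: res_irr.
pose s x := sval (cid (lift x)).
have sE x : e (V x) (s x) = res (M 0%N) (hV x) t by rewrite /s; case: cid.
have cU : U `<=` \bigcup_x V x.
  by move=> x Ux; exists (exist _ x Ux) => //; rewrite /V; case: cid => ? [].
have [x y|u [uE _]] := @sheafP X S U _ V hV cU s.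
  apply: ie; rewrite !hom_nat !sE.
  by rewrite !(res_comp _ _ (subset_trans (@oIl _ (V x) (V y)) (hV x))).
exists u; apply: (sheaf_sep (hV := hV)) => // x.
by rewrite -hom_nat uE sE.
Qed.

Hypothesis e0 : forall U s, e U s = 0 -> s = 0.
Hypothesis de : forall U s, sdiff M 0 U (e U s) = 0.
Hypothesis le : left_exact.

Fact rel_cochain_dif q (s : rel_cech_complex W S I' q) :
  bdif (cech_bicomplex W M I') q 0 (rel_cochain_map W e I' q s) = 0.
Proof. by apply: val_inj; apply: dprodP => a; exact: de. Qed.

Fact rel_cochain_del q (s : rel_cech_complex W S I' q) :
  bdel (cech_bicomplex W M I') q 0 (rel_cochain_map W e I' q s)
  = rel_cochain_map W e I' q.+1 (diff (rel_cech_complex W S I') q s).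
Proof. by rewrite -rel_cochain_map_diff. Qed.

(** The compatibility proofs [h1] and [h2] are variables, so that the result covers both
    [kernel_to_cech] and the edge map built from an arbitrary resolution. *)
Theorem rel_cech_bij h1 h2 q : good W M ->
  bijective (coh_map (@edge_r0_cmap (rel_cech_complex W S I') (cech_bicomplex W M I')
    (fun q => rel_cochain_map W e I' q) h1 h2) q).
Proof.
move=> gM; apply: edge_r0_bij => [p r x|p s|p [y yR]].
- exact: cech_columns_exact.
- move=> /(congr1 val) s0; apply: val_inj; apply: dprodP => a; apply: e0.
  exact: (congr1 (fun t : cochain W (M 0%N) p => t a) s0).
move=> /(congr1 val) dy.
have ex a : exists s : S (cap W a), e _ s = y a.
  by apply: le; exact: (congr1 (fun t : cochain W (M 1%N) p => t a) dy).
have sR : (fun a => sval (cid (ex a))) \in rel_cochains W S I' p.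
  apply/asboolP => a h; apply: e0; case: cid => /= s ->.
  by have /asboolP -> := yR.
exists (exist (fun t => t \in rel_cochains W S I' p) _ sR).
by apply: val_inj; apply: dprodP => a; rewrite /= /cochain_map; case: cid.
Qed.

End CechColumns.

(** * Comparison with the Godement resolution over an open set *)

Section GodementComparison.
Context {X : topologicalType} (U : opens X).

(** The index is shifted by one because [giter 0] is [S] itself, the term that the resolution
    augments. *)
Definition giter_sections (S : sheaf X) : complex :=
  @Complex (fun p => giter p.+1 S U) (fun p => giter_diff p.+1 S U)
    (fun p s => @giter_diffK X p.+1 S U s).

Context (M : sheaf_complex X).

Definition giter_bicomplex : bicomplex :=
  @Bicomplex (fun p r => giter p.+1 (M r) U)
    (fun p r => giter_diff p.+1 (M r) U)
    (fun p r => giter_map p.+1 (sdiff M r) U)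
    (fun p r s => @giter_diffK X p.+1 (M r) U s)
    (fun p r s => @giter_map_comp0 X p.+1 _ _ _ (sdiff M r) (sdiff M r.+1) (@sdiffK X M r) U s)
    (fun p r s => esym (@giter_diff_nat X p.+1 _ _ (sdiff M r) U s)).

Lemma giter_bicomplex_columns p r (x : giter_bicomplex p r.+1) :
  (forall q, exact_at (sdiff M q) (sdiff M q.+1)) ->
  bdif giter_bicomplex p r.+1 x = 0 -> exists y, bdif giter_bicomplex p r y = x.
Proof.
move=> ex; apply: god_exact; apply: giter_map_exact => V t.
by have [] := ex r V t.
Qed.

(** Both complexes are edges of [giter_bicomplex]. Its columns are exact because G makes locally
    exact sequences exact on sections; the rows are left as a hypothesis, since fine and flabby
    sheaves satisfy it for different reasons. *)
Lemma giter_comparison (S : sheaf X) (e : sheaf_hom S (M 0%N)) q : resolution e ->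
  (forall p r (c : giter p.+1 (M r) U), giter_diff p.+1 (M r) U c = 0 ->
     exists b, giter_diff p (M r) U b = c) ->
  (forall x : cohomology (section_complex M U) q, x = 0) <->
  (forall x : cohomology (giter_sections S) q, x = 0).
Proof.
move=> [ie ee ex] rows.
have de V s : sdiff M 0 V (e V s) = 0.
  apply/(ee V (e V s)) => x Vx; exists V, (fun y h => h); split=> //.
  by exists s; rewrite res_id.
have h1 r (x : section_complex M U r) :
    bdel giter_bicomplex 0 r (giter_diff 0 (M r) U x) = 0.
  exact: (@giter_diffK X 0 (M r) U x).
have h2 r (x : section_complex M U r) :
    bdif giter_bicomplex 0 r (giter_diff 0 (M r) U x)
    = giter_diff 0 (M r.+1) U (diff (section_complex M U) r x).
  exact: (@giter_diff_nat X 0 _ _ (sdiff M r) U x).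
have h3 p (x : giter_sections S p) :
    bdif giter_bicomplex p 0 (giter_map p.+1 e U x) = 0.
  exact: (@giter_map_comp0 X p.+1 _ _ _ e (sdiff M 0) de U x).
have h4 p (x : giter_sections S p) :
    bdel giter_bicomplex p 0 (giter_map p.+1 e U x)
    = giter_map p.+2 e U (diff (giter_sections S) p x).
  exact: (esym (@giter_diff_nat X p.+1 _ _ e U x)).
have b1 : bijective (coh_map (@edge_p0_cmap (section_complex M U) giter_bicomplex
    (fun r => giter_diff 0 (M r) U) h1 h2) q).
  apply: edge_p0_bij => [p r x|r x|r y]; first exact: rows.
    exact: giter_diff0_eq0.
  (* The case [p = 0] identifies the kernel of the first map of a row with the sections of M^r over
     [U]. *)
  exact: (rows 0%N r).
have b2 : bijective (coh_map (@edge_r0_cmap (giter_sections S) giter_bicomplex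
    (fun p => giter_map p.+1 e U) h3 h4) q).
  apply: edge_r0_bij => [p r x|p x|p y]; first exact: giter_bicomplex_columns.
    by apply: giter_map_eq0 => V s; exact: resolution_eq0.
  apply: god_exact; apply: giter_map_exact => V t.
  by have [] := ee V t.
by rewrite (cohomology0_bij b1) (cohomology0_bij b2).
Qed.

End GodementComparison.

Lemma good_flabby_resolution (X : topologicalType) (I : Type) (W : I -> opens X)
    (S : sheaf X) (K L : sheaf_complex X) (e : sheaf_hom S (K 0%N))
    (e' : sheaf_hom S (L 0%N)) :
  paracompact X -> (forall U : opens X, paracompact (set_type U)) ->
  (forall q, fine (K q)) -> resolution e -> flabby_resolution e' ->
  good W K -> good W L.
Proof.
move=> pX pU fK rK [rL fL] gK p a q q0.
rewrite (giter_comparison q rL); last first.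
  by move=> m r c; exact: giter_flabby_exact.
rewrite -(giter_comparison q rK); first exact: gK.
move=> m r c; apply: giter_fine_exact => //; exact: paracompact_set_type.
Qed.

Theorem theorem3p29 (X : topologicalType) (K : sheaf_complex X)
    (I : Type) (W : I -> opens X) (X' : opens X) (I' : set I) :
  paracompact X ->
  (forall q, fine (K q)) ->
  open_covering (fun i => W i) ->
  locally_finite (fun i => W i) ->
  cover I' (fun i => W i) = X' ->
  [/\ forall q, bijective (coh_map (section_to_cech W K) q),
      good W K ->
      forall q, bijective (coh_map (kernel_to_cech W K I') q)
    & (forall U : opens X, paracompact (set_type U)) ->
      good W K ->
      resolution (ker_incl (sdiff K 0)) ->
      forall (L : sheaf_complex X) (e : sheaf_hom (kernel_sheaf K) (L 0%N)),
      flabby_resolution e ->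
      forall q, exists f : {additive
          cohomology (rel_cech_complex W (kernel_sheaf K) I') q ->
          cohomology (vanishing_section_complex L X') q},
        bijective f].
Proof.
move=> pX fK [_ cW] _ cX'.
have cT : oT `<=` \bigcup_i W i by move=> x _; have : cover setT (fun i => W i) x by rewrite cW.
split=> [q|gK q|pU gK rK L e rL q].
- apply: edge_p0_bij => [p r [c cR] /(congr1 val) /= dc|r s|r [y yR]].
  (* For an empty I' every cochain is relative, since each tuple has an entry at [ord0]. *)
  + have [b bE] := cech_fine_exact cT (fun i => @sub_oT _ (W i)) pX (paracompact_oT pX) (fK r) dc.
    have bR : b \in rel_cochains W (K r) set0 p by apply/asboolP => a /(_ ord0).
    by exists (exist (fun t => t \in rel_cochains W (K r) set0 p) b bR); exact: val_inj.
  + move=> /(congr1 val) /= s0.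
    apply: (@sheaf_sep X (K r) oT I W (fun i => @sub_oT _ _)) => // i.
    have h : W i `<=` cap W (fun _ : 'I_1 => i) by move=> x Wx j _.
    rewrite raddf0 -(res_comp (@sub_oT _ (cap W (fun _ : 'I_1 => i))) h).
    rewrite -[res (K r) _ s]/(Defs.restrict W s (fun=> i)) s0; exact: raddf0.
  + move=> /(congr1 val) /= dy.
    have [t tE] := cech_glue cT (fun i => @sub_oT _ (W i)) dy.
    exists t; apply: val_inj; apply: dprodP => a /=.
    by rewrite (tE a (@sub_oT _ _)).
- apply: rel_cech_bij => //.
  + by move=> U s s0; exact: val_inj.
  + move=> U t dt; have kt : t \in ker (sdiff K 0 U) by rewrite kerE dt.
    by exists (exist (fun s => s \in ker (sdiff K 0 U)) t kt).
have gL : good W L by exact: (good_flabby_resolution pX pU fK rK rL gK).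
case: rL => -[ie ee ex] fL.
have de U s : sdiff L 0 U (e U s) = 0.
  apply/(ee U (e U s)) => x Ux; exists U, (fun y h => h); split=> //.
  by exists s; rewrite res_id.
(* The zigzag passes through the total complex of C(W, W'; L), reached from the Cech complex of S
   through goodness and from the sections vanishing on X' through flabbiness. *)
apply: bij_additive_comp (vanishing_to_cech_bij cT cX' q fL).
apply: (@rel_cech_bij _ _ _ _ _ _ e _ _ (rel_cochain_dif de)
  (@rel_cochain_del X I W I' L _ e)) => //.
  by move=> U s; exact: resolution_eq0.
exact: resolution_left_exact.
Qed.
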